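(* There exist constants $c>0$ and $N_0$ such that for every $n$, every set $T\subseteq V_n$ with $|T|$ even and $|T|\ge N_0$, and every vertex $v$ of $\operatorname{dom}(P_{T\text{-cut}}(n))$, the extension complexity of the radial cone $K_{\operatorname{dom}(P_{T\text{-cut}}(n))}(v)$ is at least $2^{c|T|}$. In particular (taking $T=V_n$, $n$ even), no radial cone of the odd-cut polyhedron of $K_n$ admits a linear extension of size less than $2^{cn}$ for large $n$.
   Context: $K_n=(V_n,E_n)$ is the complete graph on $n$ nodes. For $T\subseteq V_n$ with $|T|$ even, a $T$-cut is an edge set $\delta(S)=\{\{v,w\}\in E_n : v\in S,w\notin S\}$ for some $S\subseteq V_n$ with $|S\cap T|$ odd; $V_n$-cuts are called odd cuts. $P_{T\text{-cut}}(n)$ is the convex hull in $\mathbb{R}^{E_n}$ of characteristic vectors of $T$-cuts and $\operatorname{dom}(P_{T\text{-cut}}(n)) = P_{T\text{-cut}}(n)+\mathbb{R}^{E_n}_+$ (the $T$-cut polyhedron; for $T=V_n$, the odd-cut polyhedron). The radial cone $K_P(v)$ of a polyhedron $P$ at $v\in P$ is the polyhedron defined by all linear inequalities valid for $P$ satisfied with equality by $v$. A linear extension of $P$ is a pair $(Q,\pi)$ of a polyhedron $Q$ and linear map $\pi$ with $\pi(Q)=P$, of size equal to the number of facets of $Q$; extension complexity is the minimum such size. *)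

(* Defs.v *)
From Stdlib Require Import Reals.
From mathcomp Require Import all_boot.

Set Implicit Arguments.
Unset Strict Implicit.
Unset Printing Implicit Defensive.

Local Open Scope R_scope.

Definition vec (D : finType) := D -> R.

Definition dot (D : finType) (a x : vec D) : R :=
  \big[Rplus/0]_(d : D) (a d * x d).

Definition same_set (D : finType) (P Q : vec D -> Prop) : Prop :=
  forall x, P x <-> Q x.

Definition polyhedron (D : finType) (P : vec D -> Prop) : Prop :=
  exists (m : nat) (A : 'I_m -> vec D) (b : 'I_m -> R),
    forall x, P x <-> (forall i, dot (A i) x <= b i).

Definition valid_ineq (D : finType) (P : vec D -> Prop) (a : vec D) (beta : R)
  : Prop := forall x, P x -> dot a x <= beta.

Definition face (D : finType) (P F : vec D -> Prop) : Prop :=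
  exists (a : vec D) (beta : R), valid_ineq P a beta /\
    same_set F (fun x => P x /\ dot a x = beta).

Definition aff_indep (D : finType) (r : nat) (p : 'I_r -> vec D) : Prop :=
  forall lam : 'I_r -> R,
    \big[Rplus/0]_(i < r) lam i = 0 ->
    (forall d, \big[Rplus/0]_(i < r) (lam i * p i d) = 0) ->
    forall i, lam i = 0.

(* aff_rank S r : r is the maximal number of affinely independent points of S,
   i.e. dim S = r - 1 (dim of the empty set = -1) *)
Definition aff_rank (D : finType) (S : vec D -> Prop) (r : nat) : Prop :=
  (exists p : 'I_r -> vec D, (forall i, S (p i)) /\ aff_indep p) /\
  (forall (r' : nat) (p : 'I_r' -> vec D),
      (r < r')%N -> (forall i, S (p i)) -> ~ aff_indep p).

Definition facet (D : finType) (P F : vec D -> Prop) : Prop :=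
  face P F /\ exists r : nat, aff_rank P r.+1 /\ aff_rank F r.

Definition num_facets (D : finType) (P : vec D -> Prop) (f : nat) : Prop :=
  exists Fs : 'I_f -> (vec D -> Prop),
    (forall i, facet P (Fs i)) /\
    (forall i j, i <> j -> ~ same_set (Fs i) (Fs j)) /\
    (forall F, facet P F -> exists i, same_set F (Fs i)).

Definition linmap (D : finType) (k : nat) (M : D -> 'I_k -> R) (y : vec 'I_k)
  : vec D := fun d => \big[Rplus/0]_(j < k) (M d j * y j).

Definition linear_extension (D : finType) (P : vec D -> Prop)
  (k : nat) (Q : vec 'I_k -> Prop) (M : D -> 'I_k -> R) : Prop :=
  polyhedron Q /\
  forall x, P x <-> exists y, Q y /\ forall d, x d = linmap M y d.

Definition xc_at_least (D : finType) (P : vec D -> Prop) (b : R) : Prop :=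
  forall (k : nat) (Q : vec 'I_k -> Prop) (M : D -> 'I_k -> R) (f : nat),
    linear_extension P Q M -> num_facets Q f -> b <= INR f.

Definition vertex (D : finType) (P : vec D -> Prop) (v : vec D) : Prop :=
  P v /\ exists (a : vec D) (beta : R), valid_ineq P a beta /\
    dot a v = beta /\ (forall x, P x -> dot a x = beta -> x = v).

Definition radial_cone (D : finType) (P : vec D -> Prop) (v : vec D)
  : vec D -> Prop :=
  fun x => forall (a : vec D) (beta : R),
      valid_ineq P a beta -> dot a v = beta -> dot a x <= beta.

Definition conv (D I : finType) (A : I -> Prop) (p : I -> vec D)
  : vec D -> Prop :=
  fun x => exists lam : I -> R,
    (forall i, 0 <= lam i) /\ (forall i, ~ A i -> lam i = 0) /\
    \big[Rplus/0]_(i : I) lam i = 1 /\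
    (forall d, x d = \big[Rplus/0]_(i : I) (lam i * p i d)).

Definition dominant (D : finType) (P : vec D -> Prop) : vec D -> Prop :=
  fun x => exists y, P y /\ forall d, y d <= x d.

Definition edge (n : nat) := {e : 'I_n * 'I_n | (e.1 < e.2)%N}.

Definition cut_vec (n : nat) (S : {set 'I_n}) : vec (edge n) :=
  fun e => if ((val e).1 \in S) != ((val e).2 \in S) then 1 else 0.

Definition Tcut_shore (n : nat) (T : {set 'I_n}) (S : {set 'I_n}) : Prop :=
  odd #|S :&: T|.

Definition Tcut_polytope (n : nat) (T : {set 'I_n}) : vec (edge n) -> Prop :=
  conv (Tcut_shore T) (@cut_vec n).

Definition Tcut_dom (n : nat) (T : {set 'I_n}) : vec (edge n) -> Prop :=
  dominant (Tcut_polytope T).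

(* Main.v *)
(** By LP duality a linear extension of the radial cone with [f] facets writes
    every matrix of slacks of valid inequalities at points of the cone as a sum
    of [f + 1] nonnegative rank-one terms. The vertex is a cut [delta(S0)]; one
    shore meets [T] in at least half of [T]. Perfect matchings of [T] that cross
    [S0] exactly once give inequalities tight at the vertex, and all [T]-cuts
    lie in the cone. Fixing such a matching outside a set of nodes inside the
    large part of [T], the slack matrix contains the matrix
    [|delta(U) cap M| - 1] of perfect matchings [M] against odd sets [U] on
    those nodes, whose nonnegative rank is exponential (Rothvoss).

    For the latter, let [g(U) f(M)] be one rank-one term; it vanishes on pairs
    crossing once. Random pairs crossing 3 times and 5 times are generated from
    a common random frame: pairs [A_i], quadruples [B_j], and five-element sets
    [C], [D] joined by a matching of five edges. A 3-crossing uses a triple [H]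
    of these edges, and the two nodes left in [C] (the four left in [C] and [D])
    look like one more pair [A_i] (quadruple [B_j]). If [g] and [f] are not tiny
    on average, most coordinates of a dense function on the cube are nearly
    unbiased, so making that extra block behave as in a 5-crossing hardly
    changes the averages. Only five triples are used, indexed by a pentagon;
    two of them at distance 2 meet in one edge and would produce a pair
    crossing once, so at most two of the five contribute. Hence the average of
    [g f] on 3-crossings is at most about [2/5] of that on 5-crossings, whereas
    the slacks are 2 and 4. *)

Require Import Defs.
From Stdlib Require Import Reals.
From mathcomp Require Import all_boot all_order all_algebra all_fingroup.
From mathcomp Require Import boolp Rstruct.
From mathcomp Require Import zify ring lra.

Set Implicit Arguments.
Unset Strict Implicit.
Unset Printing Implicit Defensive.

Import Order.TTheory GRing.Theory Num.Theory.
Local Open Scope ring_scope.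

Arguments exp x%_ring_scope.
Bind Scope ring_scope with R.

(** * The cube *)

Lemma expR_ge1D (x : R) : 1 + x <= exp x.
Proof. by apply/RleP; exact: exp_ineq1_le. Qed.

Lemma expR_gt0 (x : R) : 0 < exp x.
Proof. by apply/RltP; exact: exp_pos. Qed.

Lemma expRD (x y : R) : exp (x + y) = exp x * exp y.
Proof. exact: exp_plus. Qed.

Lemma expRN (x : R) : exp x * exp (- x) = 1.
Proof. by rewrite -expRD subrr exp_0. Qed.

Lemma ler_expR (x y : R) : (exp x <= exp y) = (x <= y).
Proof.
apply/idP/idP => [le_exp | /RleP le_xy].
  rewrite leNgt; apply/negP => /RltP lt_yx.
  by move: le_exp; apply/negP; rewrite -ltNge; apply/RltP; exact: exp_increasing.
apply/RleP; case: le_xy => [lt_xy | ->]; last exact: Rle_refl.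
by left; exact: exp_increasing.
Qed.

Lemma expR_sum (I : finType) (F : I -> R) :
  exp (\sum_i F i) = \prod_i exp (F i).
Proof.
apply: (big_morph exp (id1 := 1) (op1 := *%R)) => [x y|]; last exact: exp_0.
exact: expRD.
Qed.

(** From [exp (- x) >= 1 - x] follows [exp x <= 1 / (1 - x)]; multiplying the claimed bound by
    [1 - x] leaves the surplus [x ^+ 2 * (1 - 2 * x)] over 1. *)
Lemma expR_le_quad (x : R) : `|x| <= 1/2 -> exp x <= 1 + x + 2 * x ^+ 2.
Proof.
rewrite ler_norml => /andP[x_lo x_hi].
have e1 := expR_ge1D (- x); have e2 := expRN x; have e3 := expR_gt0 x.
have : exp x * (1 - x) <= 1 by rewrite -[leRHS]e2 ler_pM2l.
have pos : 0 < 1 - x by lra.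
rewrite -[exp x <= _](ler_pM2r pos); move/le_trans; apply.
rewrite -subr_ge0 (_ : _ - 1 = x ^+ 2 * (1 - 2 * x)); last by ring.
by rewrite mulr_ge0 ?sqr_ge0 //; lra.
Qed.

Lemma two_cosh_le (x : R) : `|x| <= 1/2 -> exp x + exp (- x) <= 2 * exp (2 * x ^+ 2).
Proof.
move=> hx; have e1 := expR_le_quad hx.
have e2 : exp (- x) <= 1 + - x + 2 * (- x) ^+ 2 by apply: expR_le_quad; rewrite normrN.
have e3 := expR_ge1D (2 * x ^+ 2); rewrite sqrrN in e2.
lra.
Qed.

Section Cube.
Variables (X : finType) (G : {set X} -> R) (alpha delta : R).
Hypotheses (G_ge0 : forall I, 0 <= G I) (G_le : forall I, G I <= alpha).

(** [G] is read as an unnormalised density on the cube of subsets of [X]; coordinate [i] is unbiased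
    when its two masses agree. *)
Definition mass_in (i : X) : R := \sum_(I : {set X} | i \in I) G I.
Definition mass_out (i : X) : R := \sum_(I : {set X} | i \notin I) G I.
Definition mass : R := \sum_(I : {set X}) G I.

Lemma massE (i : X) : mass = mass_in i + mass_out i.
Proof. exact: bigID. Qed.

Lemma mass_in_ge0 i : 0 <= mass_in i. Proof. exact: sumr_ge0. Qed.
Lemma mass_out_ge0 i : 0 <= mass_out i. Proof. exact: sumr_ge0. Qed.

(* Exponential moments: tilt the density [G] by [exp Y], where [Y] is the signed
   sum of the [s i], and use convexity of [exp] at the mean of [Y] under [G]. *)
Lemma mass_bias (s : X -> R) :
  (forall i, `|s i| <= 1/2) ->
  alpha * 2 ^+ #|X| * exp (- (delta * #|X|%:R)) < mass ->
  \sum_i s i * (mass_in i - mass_out i)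
    <= mass * (delta * #|X|%:R + 2 * \sum_i s i ^+ 2).
Proof.
move=> s_small mass_big.
have alpha_ge0 : 0 <= alpha by exact: le_trans (G_ge0 set0) (G_le set0).
have mass_gt0 : 0 < mass.
  apply: le_lt_trans mass_big.
  by rewrite !mulr_ge0 ?exprn_ge0 ?(ltW (expR_gt0 _)).
pose sgn (i : X) (I : {set X}) : R := if i \in I then s i else - s i.
pose Y I := \sum_i sgn i I.
pose W := \sum_(I : {set X}) G I * Y I.
have WE : \sum_i s i * (mass_in i - mass_out i) = W.
  rewrite /W; under [RHS]eq_bigr do rewrite mulr_sumr.
  rewrite exchange_big; apply: eq_bigr => i _ /=.
  rewrite [RHS](bigID (fun I : {set X} => i \in I)) /= mulrBr !mulr_sumr -sumrN.
  congr (_ + _); apply: eq_bigr => I; rewrite /sgn; first by move=> ->; rewrite mulrC.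
  by move=> /negbTE ->; rewrite mulrN mulrC.
rewrite WE.
set a := W / mass.
have lower : mass * exp a <= \sum_(I : {set X}) G I * exp (Y I).
  have -> : mass * exp a = \sum_(I : {set X}) G I * (exp a * (1 + (Y I - a))).
    transitivity (exp a * ((1 - a) * mass + W)).
      rewrite /a; have : mass != 0 by rewrite gt_eqF.
      by move=> nz; field.
    rewrite /W /mass mulr_sumr -big_split mulr_sumr; apply: eq_bigr => I _ /=; ring.
  apply: ler_sum => I _; apply: ler_wpM2l => //.
  have -> : exp (Y I) = exp a * exp (Y I - a) by rewrite -expRD addrC subrK.
  by rewrite ler_pM2l ?expR_gt0 ?expR_ge1D.
(* Once [G] is replaced by its bound [alpha], the sum over the cube factors over the coordinates
   into hyperbolic cosines. *)
have upper : \sum_(I : {set X}) G I * exp (Y I)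
    <= alpha * 2 ^+ #|X| * exp (2 * \sum_i s i ^+ 2).
  apply: (@le_trans _ _ (\sum_(I : {set X}) alpha * exp (Y I))).
    by apply: ler_sum => I _; apply: ler_wpM2r; rewrite ?(ltW (expR_gt0 _)).
  rewrite -mulr_sumr -mulrA; apply: ler_wpM2l => //.
  have -> : \sum_(I : {set X}) exp (Y I) = \prod_i (exp (s i) + exp (- s i)).
    rewrite (bigA_distr _ _ (fun i => exp (s i)) (fun i => exp (- s i))) /=.
    apply: eq_bigr => I _; rewrite /Y expR_sum; apply: eq_bigr => i _.
    by rewrite /sgn; case: ifP.
  have -> : 2 ^+ #|X| * exp (2 * \sum_i s i ^+ 2) = \prod_i (2 * exp (2 * s i ^+ 2)).
    by rewrite big_split /= prodr_const mulr_sumr expR_sum.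
  apply: ler_prod => i _; rewrite two_cosh_le // andbT.
  by rewrite addr_ge0 ?(ltW (expR_gt0 _)).
have : exp a <= exp (delta * #|X|%:R + 2 * \sum_i s i ^+ 2).
  rewrite -(ler_pM2l mass_gt0); apply: le_trans (le_trans lower upper) _.
  rewrite expRD mulrA; apply: ler_wpM2r; first by rewrite ltW ?expR_gt0.
  have e2 := expRN (delta * #|X|%:R); have e3 := expR_gt0 (delta * #|X|%:R).
  rewrite -(ler_pM2r (expR_gt0 (- (delta * #|X|%:R)))) -mulrA e2 mulr1.
  exact: ltW.
by rewrite ler_expR /a ler_pdivrMr // mulrC.
Qed.

(* A biased coordinate shifts the mean by at least [1/41] of the mass, since
   [(21/20 - 1) / (21/20 + 1) = 1/41]; the tilt is [1/164] with [164 = 4 * 41]. *)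
Lemma mass_out_biased :
  (0 < #|X|)%N -> 0 <= delta <= 1/(300 * 100 * 100) ->
  \sum_(i | (21/20) * mass_in i < mass_out i) mass_out i <=
  (1/50) * (\sum_i mass_out i)
  + #|X|%:R * (alpha * 2 ^+ #|X| * exp (- (delta * #|X|%:R))).
Proof.
move=> X_gt0 /andP[delta_ge0 delta_le].
set n : R := #|X|%:R; set eta := alpha * _ * _.
pose L i := (21/20) * mass_in i < mass_out i.
rewrite (eq_bigl L) //.
have alpha_ge0 : 0 <= alpha by exact: le_trans (G_ge0 set0) (G_le set0).
have n_gt0 : 0 < n by rewrite ltr0n.
have out_le i : mass_out i <= mass by rewrite (massE i) lerDr mass_in_ge0.
have sum_ge0 : 0 <= \sum_i mass_out i by apply: sumr_ge0 => i _; exact: mass_out_ge0.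
have cardL_le : \sum_(i | L i) mass_out i <= #|L|%:R * mass.
  by rewrite -sum1_card natr_sum mulr_suml; apply: ler_sum => i _; rewrite mul1r.
(* A density of small total mass is paid for by the error term alone; otherwise the moment bound is
   available. *)
have [mass_small | mass_big] := leP mass eta.
  have : #|L|%:R * mass <= n * eta.
    apply: ler_pM => //; first by apply: sumr_ge0.
    by rewrite ler_nat max_card.
  lra.
have eta_ge0 : 0 <= eta by rewrite !mulr_ge0 ?exprn_ge0 ?(ltW (expR_gt0 _)).
have mass_gt0 := le_lt_trans eta_ge0 mass_big.
(* Tilting all coordinates equally shows that the sets cannot contain almost all of [X] on
   average. *)
have half : n * mass <= 4 * \sum_i mass_out i.
  have := @mass_bias (fun=> 1/8) _ mass_big.
  have norm8 : `|1/8 : R| <= 1/2 by rewrite ger0_norm; lra.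
  move/(_ (fun=> norm8)).
  rewrite /= -mulr_sumr sumr_const -mulr_natl -/n.
  have -> : \sum_i (mass_in i - mass_out i) = n * mass - 2 * \sum_i mass_out i.
    have -> : n * mass = \sum_(i : X) mass by rewrite sumr_const mulr_natl.
    rewrite mulr_sumr -sumrB; apply: eq_bigr => i _; rewrite (massE i); ring.

  have : mass * (delta * n) <= mass * (1/(300 * 100 * 100) * n).
    by rewrite ler_pM2l // ler_pM2r.
  have : 0 < n * mass by exact: mulr_gt0.
  lra.
(* Per biased coordinate the bias gains [4 / 164 ^+ 2] and the quadratic term costs [2 / 164 ^+ 2].
   The bound on [delta] makes the right side less than [n / 200]; with the factor 4 of [half] this
   gives the share [1/50]. *)
have few : #|L|%:R <= (2 * (82 * 82)) * (delta * n).
  have := @mass_bias (fun i => if L i then - (1/164) else 0) _ mass_big.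
  have nrm i : `|if L i then - (1/164) else 0 : R| <= 1/2.
    by case: ifP => _; rewrite ?normrN ger0_norm; lra.
  move/(_ nrm).
  have -> : \sum_i (if L i then - (1/164) else 0 : R) ^+ 2 = #|L|%:R * (1/164)^+2.
    rewrite mulr_natl -sumr_const [RHS]big_mkcond /=; apply: eq_bigr => i _.
    rewrite -[i \in _]/(L i); case: (L i); first by rewrite sqrrN.
    by rewrite expr0n.
  have : #|L|%:R * mass * (1/41) * (1/164)
      <= \sum_i (if L i then - (1/164) else 0) * (mass_in i - mass_out i).
    have -> : #|L|%:R * mass * (1/41) * (1/164) = \sum_(i | L i) (mass * (1/41) * (1/164)).
      by rewrite -!mulrA mulr_natl -sumr_const; apply: eq_bigl => i.
    rewrite big_mkcond; apply: ler_sum => i _; case: ifP; rewrite ?mul0r // => Li.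
    have : mass * (1/41) <= mass_out i - mass_in i.
      by rewrite (massE i); move: Li; rewrite /L; lra.
    lra.
  move=> h1 h2; have := le_trans h1 h2; rewrite -/n.
  have -> : #|L|%:R * mass * (1/41) * (1/164) = mass * (#|L|%:R * (1/41 * (1/164))) by ring.
  rewrite ler_pM2l //; lra.
have : #|L|%:R * mass <= (2 * (82 * 82)) * (delta * n) * mass by rewrite ler_pM2r.
have : delta * (n * mass) <= (1/(300 * 100 * 100)) * (n * mass).
  by rewrite ler_pM2r // mulr_gt0.
have : 0 <= n * eta by rewrite mulr_ge0 // ltW.
lra.
Qed.

End Cube.

(** * Exchanging a distinguished coordinate for a random one *)

Section Exchange.
Variables (Gam : finGroupType) (X : finType) (x0 : X) (tau : X -> Gam).
Variables (G : Gam -> {set X} -> R) (w : Gam -> R) (alpha beta delta : R).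
Hypotheses (G_ge0 : forall p I, 0 <= G p I) (G_le : forall p I, G p I <= alpha).
Hypotheses (w_ge0 : forall p, 0 <= w p) (w_le : forall p, w p <= beta).
Hypothesis Gtau : forall p i I, G (p * tau i)%g I = G p (tperm x0 i @^-1: I).
Hypothesis wtau : forall p i, w (p * tau i)%g = w p.
Hypothesis delta_small : 0 <= delta <= 1/(300 * 100 * 100).

Lemma tperm_preim_inj i : injective (fun I : {set X} => tperm x0 i @^-1: I).
Proof.
move=> I J /setP eqIJ; apply/setP => x.
by have := eqIJ (tperm x0 i x); rewrite !inE tpermK.
Qed.

Lemma mass_out_tau p i : mass_out (G (p * tau i)%g) x0 = mass_out (G p) i.
Proof.
rewrite /mass_out [RHS](reindex_inj (@tperm_preim_inj i)) /=.
by apply: eq_big => [I | I _]; rewrite ?inE ?tpermR ?Gtau.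
Qed.

Lemma mass_in_tau p i : mass_in (G (p * tau i)%g) x0 = mass_in (G p) i.
Proof.
rewrite /mass_in [RHS](reindex_inj (@tperm_preim_inj i)) /=.
by apply: eq_big => [I | I _]; rewrite ?inE ?tpermR ?Gtau.
Qed.

Lemma avg_tau (phi : Gam -> R) :
  #|X|%:R * \sum_p phi p = \sum_p \sum_i phi (p * tau i)%g.
Proof.
rewrite exchange_big /= mulr_natl -sumr_const; apply: eq_bigr => i _.
by rewrite (reindex_inj (mulIg (tau i))).
Qed.

(** Translation by [tau i] moves coordinate [i] into the place of [x0] and keeps the weight.
    Averaged over the group, [x0] is thus a uniformly random coordinate, and the bound on biased
    coordinates applies to each [p] separately. *)
Lemma exchange_biased :
  \sum_(p | (21/20) * mass_in (G p) x0 < mass_out (G p) x0) mass_out (G p) x0 * w p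
  <= (1/50) * (\sum_p mass_out (G p) x0 * w p)
     + #|Gam|%:R * (beta * (alpha * 2 ^+ #|X| * exp (- (delta * #|X|%:R)))).
Proof.
have X_gt0 : (0 < #|X|)%N by apply/card_gt0P; exists x0.
have n_gt0 : 0 < #|X|%:R :> R by rewrite ltr0n.
rewrite big_mkcond -(ler_pM2l n_gt0) mulrDr [X in _ <= X + _]mulrCA !avg_tau.
rewrite mulr_sumr.
have -> : forall a b : R, a * (#|Gam|%:R * b) = \sum_(p : Gam) a * b.
  by move=> a b; rewrite sumr_const -[RHS]mulr_natl mulrCA.
rewrite -big_split; apply: ler_sum => p _ /=.
set eta := alpha * _ * _.
have eta_ge0 : 0 <= eta.
  have alpha_ge0 := le_trans (G_ge0 p set0) (G_le p set0).
  by rewrite !mulr_ge0 ?exprn_ge0 ?(ltW (expR_gt0 _)).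
under eq_bigr do rewrite mass_in_tau mass_out_tau wtau.
under [X in _ <= _ * X + _]eq_bigr do rewrite mass_out_tau wtau.
rewrite -big_mkcond -!mulr_suml.
have bound := mass_out_biased (G_ge0 p) (G_le p) X_gt0 delta_small.
apply: le_trans (ler_wpM2r (w_ge0 p) bound) _.
have := ler_wpM2l (mulr_ge0 (ltW n_gt0) eta_ge0) (w_le p).
rewrite -/eta; lra.
Qed.

End Exchange.

(** * Perfect matchings and crossing numbers *)

Lemma even_card_involution (V : finType) (f : V -> V) (S : {set V}) :
  (forall x, x \in S -> [/\ f x \in S, f x != x & f (f x) = x]) -> ~~ odd #|S|.
Proof.
have [n] := ubnP #|S|; elim: n S => // n IHn S lt_n fS.
have [-> | [x xS]] := set_0Vmem S; first by rewrite cards0.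
have [fxS fx_neq ffx] := fS x xS.
rewrite (cardsD1 x) (cardsD1 (f x)) xS !inE fx_neq fxS /= negbK.
apply: IHn => [|y].
  by move: lt_n; rewrite (cardsD1 x) xS (cardsD1 (f x)) !inE fx_neq fxS; lia.
rewrite !inE => /and3P[y_fx y_x yS]; have [fyS fy_neq ffy] := fS y yS.
split=> //; rewrite fyS andbT; apply/andP; split.
  by apply: contraNneq y_x => e; rewrite -ffy e ffx.
by apply: contraNneq y_fx => e; rewrite -ffy e.
Qed.

(** A perfect matching is a fixed-point-free involution, so that relabelling the nodes becomes
    conjugation. In [cross] each crossing edge is counted by its end in [U]. *)
Definition matching (V : finType) (M : V -> V) : Prop :=
  forall x, M x != x /\ M (M x) = x.

Definition cross (V : finType) (U : {set V}) (M : V -> V) : nat :=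
  #|[set x in U | M x \notin U]|.

(** The nodes of [U] matched inside [U] come in pairs. *)
Lemma odd_cross (V : finType) (U : {set V}) (M : V -> V) :
  matching M -> odd (cross U M) = odd #|U|.
Proof.
move=> matM; rewrite -[in RHS](cardsID [set x | M x \in U] U) oddD.
rewrite [X in _ = X (+) _]negbTE ?addFb.
  by congr (odd #|pred_of_set _|); apply/setP => x; rewrite !inE andbC.
apply: (@even_card_involution _ M) => x; rewrite !inE => /andP[xU MxU].
by have [neq MM] := matM x; rewrite ?inE; split=> //; rewrite MM xU MxU.
Qed.

Lemma cross_preim (V : finType) (p : {perm V}) (U : {set V}) (M : {perm V}) :
  cross (p @^-1: U) (p * M * p^-1)%g = cross U M.
Proof.
rewrite /cross -[in RHS](card_preimset _ (@perm_inj _ p)).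
congr #|pred_of_set _|; apply/setP => x.
by rewrite !inE !permM permKV.
Qed.

Lemma matching_conj (V : finType) (p M : {perm V}) :
  matching M -> matching (p * M * p^-1)%g.
Proof.
move=> matM x; have [neq MM] := matM (p x); rewrite !permM permKV MM permK.
by split=> //; apply: contraNneq neq => {2}<-; rewrite permKV.
Qed.

(** * Frames *)

Section Nodes.
Variable m : nat.

(* The ground set: pairs [A_i] (first summand), the sets [C] (flag [false]) and
   [D] (flag [true]) of five nodes each, and quadruples [B_j] made of a pair on
   the [C] side and a pair on the [D] side. *)
Definition node : finType :=
  (('I_m * bool) + ('I_5 * bool) + ('I_m * (bool * bool)))%type.

Definition nA (i : 'I_m) (b : bool) : node := inl (inl (i, b)).
Definition nC (j : 'I_5) (d : bool) : node := inl (inr (j, d)).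
Definition nB (i : 'I_m) (d b : bool) : node := inr (i, (d, b)).

Lemma card_node : #|node| = (6 * m + 10)%N.
Proof. by rewrite !card_sum !card_prod !card_ord !card_bool; lia. Qed.

Variable h : 'I_5.

(* The pair [{c_h, c_(h+1)}] of [C] (and likewise in [D]); the three remaining
   edges of the matching between [C] and [D] form the triple [H_h]. *)
Definition inpair (j : 'I_5) : bool := (j == h) || (j == h + 1).
Definition mate (j : 'I_5) : 'I_5 := if j == h then h + 1 else h.
(** Labels the two ends of the pair by booleans, inversely to [j == h + 1], so that the pair can
    change places with a pair [nA i]. *)
Definition off (b : bool) : 'I_5 := if b then h + 1 else h.

Lemma h1_neq : (h + 1 == h) = false.
Proof. by case: h => -[|[|[|[|[|]]]]]. Qed.

Lemma mateK j : inpair j -> mate (mate j) = j.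
Proof.
by rewrite /inpair /mate => /orP[] /eqP->; rewrite ?eqxx ?h1_neq ?eqxx.
Qed.

Lemma mate_neq j : inpair j -> (mate j == j) = false.
Proof.
by rewrite /inpair /mate => /orP[] /eqP->; rewrite ?eqxx ?h1_neq // eq_sym h1_neq.
Qed.

Lemma inpair_mate j : inpair (mate j).
Proof. by rewrite /inpair /mate; case: ifP; rewrite eqxx ?orbT. Qed.

Lemma inpair_off b : inpair (off b).
Proof. by rewrite /inpair /off; case: b; rewrite eqxx ?orbT. Qed.

Lemma mate_off b : mate (off b) = off (~~ b).
Proof. by rewrite /mate /off; case: b; rewrite ?eqxx ?h1_neq. Qed.

Lemma off_eq b : (off b == h + 1) = b.
Proof. by rewrite /off; case: b; rewrite ?eqxx // eq_sym h1_neq. Qed.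

Lemma offK j : inpair j -> off (j == h + 1) = j.
Proof.
by rewrite /inpair /off => /orP[] /eqP->; rewrite ?eqxx // eq_sym h1_neq.
Qed.

(** [None] is the coordinate of the extra block, here the pair of [C]. The other three nodes of [C]
    always belong to the set and make its size odd. *)
Definition Uset (I : {set option 'I_m}) : {set node} :=
  [set x : node | match x with
    | inl (inl (i, _)) => Some i \in I
    | inl (inr (j, d)) => ~~ d && ((None \in I) || ~~ inpair j)
    | inr _ => false
    end].

(** A block of [J] is matched between the [C] side and the [D] side, the other blocks within each
    side; here the extra block [None] consists of the pairs of [C] and of [D]. The triple always
    runs from [C] to [D]. *)
Definition Mfun (J : {set option 'I_m}) (x : node) : node :=
  match x with
  | inl (inl (i, b)) => nA i (~~ b)
  | inl (inr (j, d)) =>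
      if inpair j && (None \notin J) then nC (mate j) d else nC j (~~ d)
  | inr (i, (d, b)) => if Some i \in J then nB i (~~ d) b else nB i d (~~ b)
  end.

Lemma Mfun_matching J : matching (Mfun J).
Proof.
case=> [[[i b]|[j d]]|[i [d b]]] /=.
- by rewrite negbK; split=> //; apply/eqP; case; case: b.
- case: ifP => [/andP[jP NJ] | jP] /=.
    rewrite inpair_mate NJ /= mateK //; split=> //.
    by apply/eqP; case=> e; move: (mate_neq jP); rewrite e eqxx.
  by rewrite jP negbK; split=> //; apply/eqP; case; case: d {jP}.
- case: ifP => iJ /=; rewrite iJ negbK; split=> //; apply/eqP; case.
    by case: d.
  by case: b.
Qed.

Lemma Mfun_inj J : injective (Mfun J).
Proof. by move=> x y e; rewrite -(Mfun_matching J x).2 e (Mfun_matching J y).2. Qed.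

Definition Mperm J : {perm node} := perm (@Mfun_inj J).

Lemma Mperm_matching J : matching (Mperm J).
Proof. by move=> x; rewrite !permE; exact: Mfun_matching. Qed.

(** The swaps make the extra block and block [i] change places: [swapA] moves only the pair in [C],
    [swapB] the pairs in [C] and [D]. For [None] they are the identity. *)
Definition swapA_fun (i : option 'I_m) (x : node) : node :=
  if i is Some i0 then
    match x with
    | inl (inl (k, b)) => if k == i0 then nC (off b) false else x
    | inl (inr (j, d)) => if ~~ d && inpair j then nA i0 (j == h + 1) else x
    | inr _ => x
    end
  else x.

Definition swapB_fun (i : option 'I_m) (x : node) : node :=
  if i is Some i0 then
    match x with
    | inl (inl _) => x
    | inl (inr (j, d)) => if inpair j then nB i0 d (j == h + 1) else x
    | inr (k, (d, b)) => if k == i0 then nC (off b) d else x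
    end
  else x.

Lemma swapA_funK i : involutive (swapA_fun i).
Proof.
case: i => [i|] //= [[[k b]|[j d]]|[k [d b]]] //=.
  by case: eqP => [->|/eqP/negbTE ne] /=; rewrite ?inpair_off ?off_eq // ne.
by case: ifP => [/andP[/negbTE-> jP]|] /=; rewrite ?eqxx ?offK // => ->.
Qed.

Lemma swapB_funK i : involutive (swapB_fun i).
Proof.
case: i => [i|] //= [[[k b]|[j d]]|[k [d b]]] //=.
  by case: ifP => [jP|] /=; rewrite ?eqxx ?offK // => ->.
by case: eqP => [->|/eqP/negbTE ne] /=; rewrite ?inpair_off ?off_eq // ne.
Qed.

Definition swapA i : {perm node} := perm (inv_inj (swapA_funK i)).
Definition swapB i : {perm node} := perm (inv_inj (swapB_funK i)).

Lemma swapA_V i x : (swapA i)^-1%g x = swapA i x.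
Proof. by apply: (canLR (permK _)); rewrite !permE swapA_funK. Qed.

Lemma swapB_V i x : (swapB i)^-1%g x = swapB i x.
Proof. by apply: (canLR (permK _)); rewrite !permE swapB_funK. Qed.

Lemma Uset_swapA i (I : {set option 'I_m}) : swapA i @^-1: Uset I = Uset (tperm None i @^-1: I).
Proof.
apply/setP => x; rewrite !inE permE.
case: i => [i|]; last first.
  by rewrite /= tperm1; case: x => [[[k b]|[j d]]|y] //=; rewrite ?inE ?perm1.
case: x => [[[k b]|[j d]]|y] //=; rewrite ?inE.
  case: eqP => [->|/eqP ne] /=; first by rewrite tpermR inpair_off orbF.
  by rewrite tpermD // eq_sym.
rewrite tpermL; case: d => //=; case: ifP => /= jP; first by rewrite orbF.
by rewrite jP !orbT.
Qed.

(** With [None] outside [I], neither the extra pairs nor the quadruples meet the set. *)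
Lemma Uset_swapB i (I : {set option 'I_m}) : None \notin I -> swapB i @^-1: Uset I = Uset I.
Proof.
move=> NI; apply/setP => x; rewrite !inE permE.
case: i => [i|] //; case: x => [[[k b]|[j d]]|[k [d b]]] //=; rewrite (negbTE NI) /=.
  by case: ifP => jP; rewrite ?jP /= ?(negbTE NI) ?andbF ?jP.
by case: ifP => _ /=; rewrite ?(negbTE NI) ?inpair_off ?andbF.
Qed.

Lemma Mperm_swapB i (J : {set option 'I_m}) :
  (swapB i * Mperm J * (swapB i)^-1)%g = Mperm (tperm None i @^-1: J).
Proof.
apply/permP => x; rewrite !permM swapB_V !permE.
case: i => [i|]; last first.
  by rewrite /= tperm1; case: x => [[[k b]|[j d]]|[k [d b]]] //=; rewrite ?inE ?perm1.
case: x => [[[k b]|[j d]]|[k [d b]]] //=; rewrite ?inE ?tpermL.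
  case: ifP => jP /=; last by rewrite jP /= jP.
  by case: (Some i \in J) => /=; rewrite eqxx ?offK // -mate_off offK.
case: eqP => [->|/eqP ne] /=.
  rewrite tpermR inpair_off mate_off /=.
  by case: (None \in J) => /=; rewrite inpair_off off_eq.
by rewrite tpermD ?(inj_eq Some_inj) // 1?eq_sym //; case: ifP => _ /=; rewrite (negbTE ne).
Qed.

(** With [None] outside [J], the extra pair in [C] is an edge of the matching, just like each pair
    [nA i]. *)
Lemma Mperm_swapA i (J : {set option 'I_m}) : None \notin J ->
  (swapA i * Mperm J * (swapA i)^-1)%g = Mperm J.
Proof.
move=> NJ; apply/permP => x; rewrite !permM swapA_V !permE.
case: i => [i|] //; case: x => [[[k b]|[j d]]|[k [d b]]] //=; rewrite ?NJ ?andbT.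
- case: eqP => [->|/eqP ne] /=.
    by rewrite inpair_off NJ mate_off /= inpair_off off_eq.
  by rewrite (negbTE ne).
- case: d => /=; first by case jP: (inpair j) => /=; rewrite ?NJ ?jP.
  case jP: (inpair j) => /=; last by rewrite ?jP.
  by rewrite eqxx -mate_off offK.
- by case: ifP.
Qed.

End Nodes.

(** * Crossing numbers within a frame *)

Section CrossNodes.
Variable m : nat.
Implicit Types I J : {set option 'I_m}.

(** Only nodes of [C] count: the pairs [nA i] are matched within themselves, and the set avoids [D]
    and the quadruples. The triples of the set and of the matching may differ, so that one formula
    serves crossings 1, 3 and 5. *)
Lemma cross_nodes (h k : 'I_5) I J :
  cross (Uset h I) (Mperm k J) =
  #|[set j | ((None \in I) || ~~ inpair h j) &&
      ((inpair k j && (None \notin J)) ==>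
         ~~ ((None \in I) || ~~ inpair h (mate k j)))]|.
Proof.
rewrite -(card_imset (f := fun j => nC m j false)); last by move=> i j [].
congr #|pred_of_set _|; apply/setP => x.
have notC : (forall j, x != nC m j false) ->
    x \in [set nC m j false | j in [set j | ((None \in I) || ~~ inpair h j) &&
      ((inpair k j && (None \notin J)) ==>
         ~~ ((None \in I) || ~~ inpair h (mate k j)))]] = false.
  move=> ne; apply/negbTE/imsetP => -[j _ e].
  by move: (ne j); rewrite e eqxx.
case: x notC => [[[i b]|[j d]]|[i [d b]]] notC; rewrite !inE permE /=.
- by rewrite notC ?inE ?andbN // => j; apply/eqP.
- case: d notC => notC /=; first by rewrite notC // => j'; apply/eqP; case.
  rewrite [RHS](mem_imset (f := fun j => nC m j false)); last by move=> ? ? [].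
  by rewrite inE; congr (_ && _); case: (inpair k j && _).
- by rewrite notC // => j; apply/eqP.
Qed.

Lemma cross3 (h : 'I_5) I J : None \notin I -> None \notin J ->
  cross (Uset h I) (Mperm h J) = 3.
Proof.
move=> /negbTE NI /negbTE NJ; rewrite cross_nodes NI NJ /=.
rewrite (_ : [set _ | _] = ~: [set h; h + 1]); last first.
  by apply/setP => j; rewrite !inE andbT -/(inpair h j); case: (inpair h j).
by rewrite cardsCs setCK cards2 card_ord eq_sym h1_neq.
Qed.

Lemma cross5 (h k : 'I_5) I J : None \in I -> None \in J ->
  cross (Uset h I) (Mperm k J) = 5.
Proof.
move=> NI NJ; rewrite cross_nodes NI NJ /=.
rewrite (_ : [set _ | _] = [set: 'I_5]); first by rewrite cardsT card_ord.
by apply/setP => j; rewrite !inE andbF.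
Qed.

(** The triples for [h] and [h + 2] share only [h + 4]; the other two nodes of the set in [C] are
    matched to each other. *)
Lemma cross1 (h : 'I_5) I J : None \notin I -> None \notin J ->
  cross (Uset h I) (Mperm (h + 2) J) = 1.
Proof.
move=> /negbTE NI /negbTE NJ; rewrite cross_nodes NI NJ /=.
rewrite (_ : [set _ | _] = [set h + 4]); first by rewrite cards1.
apply/setP => j; rewrite !inE /inpair /mate andbT.
by case: h j => [[|[|[|[|[|//]]]]] ?] [[|[|[|[|[|//]]]]] ?].
Qed.

(** Configurations crossing five times forget the triple, so all five choices of [h] are compared
    with the same average. *)
Lemma Uset_in (h k : 'I_5) I : None \in I -> Uset h I = Uset k I.
Proof. by move=> NI; apply/setP => -[[[i b]|[j d]]|y]; rewrite !inE ?NI. Qed.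

Lemma Mperm_in (h k : 'I_5) J : None \in J -> Mperm h J = Mperm k J.
Proof.
move=> NJ; apply/permP => x; rewrite !permE /Mfun.
by case: x => [[[i b]|[j d]]|[i [d b]]]; rewrite ?NJ ?andbF.
Qed.

Lemma odd_Uset (h : 'I_5) I : odd #|Uset h I|.
Proof.
have [NI | NI] := boolP (None \in I).
  by rewrite -(odd_cross _ (@Mperm_matching m h setT)) cross5 ?inE.
by rewrite -(odd_cross _ (@Mperm_matching m h set0)) cross3 ?inE.
Qed.

End CrossNodes.

(** The steps [h] to [h + 2] form a cycle of length 5, in which no three vertices are pairwise
    non-adjacent; so at most two terms are positive. *)
Lemma pentagon_sum (t : 'I_5 -> R) (q : R) :
  0 <= q -> (forall h, t h <= q) -> (forall h, t h <= 0 \/ t (h + 2) <= 0) ->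
  \sum_h t h <= 2 * q.
Proof.
move=> q_ge0 t_le t_or.
pose i k : 'I_5 := inZp k.
have sumE : \sum_h t h = t (i 0%N) + t (i 1%N) + t (i 2%N) + t (i 3%N) + t (i 4%N).
  rewrite !big_ord_recl big_ord0 addr0 !addrA.
  by congr (t _ + t _ + t _ + t _ + t _); apply/val_inj.
have step k : t (i k) <= 0 \/ t (i (k + 2)%N) <= 0.
  have := t_or (i k); congr (_ \/ t _ <= 0); apply/val_inj => /=.
  by rewrite modnDml.
have i5 : i 5%N = i 0%N by apply/val_inj.
have i6 : i 6%N = i 1%N by apply/val_inj.
have := step 0%N; have := step 1%N; have := step 2%N.
have := step 3%N; have := step 4%N; rewrite !add0n i5 i6 sumE /=.
have := t_le (i 0%N); have := t_le (i 1%N); have := t_le (i 2%N).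
have := t_le (i 3%N); have := t_le (i 4%N).
move=> ? ? ? ? ? [?|?] [?|?] [?|?] [?|?] [?|?]; lra.
Qed.

(** * A single rank-one term: 3-crossings against 5-crossings *)

Section RankOne.
Variables (m : nat) (g : {set node m} -> R) (f : {perm node m} -> R).
Variables (alpha beta delta : R).
Hypotheses (g_ge0 : forall U : {set node m}, odd #|U| -> 0 <= g U)
  (g_le : forall U : {set node m}, odd #|U| -> g U <= alpha).
Hypotheses (f_ge0 : forall M : {perm node m}, matching M -> 0 <= f M)
  (f_le : forall M : {perm node m}, matching M -> f M <= beta).
Hypothesis gf0 : forall (U : {set node m}) (M : {perm node m}),
  odd #|U| -> matching M -> cross U M = 1%N -> g U * f M = 0.
Hypothesis delta_small : 0 <= delta <= 1/(300 * 100 * 100).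

Definition gU (p : {perm node m}) (h : 'I_5) (I : {set option 'I_m}) : R :=
  g (p @^-1: Uset h I).
Definition fM (p : {perm node m}) (h : 'I_5) (J : {set option 'I_m}) : R :=
  f (p * Mperm h J * p^-1)%g.

Let odd_pU (p : {perm node m}) h I : odd #|p @^-1: Uset h I|.
Proof. by rewrite card_preimset ?odd_Uset //; exact: perm_inj. Qed.
Let matching_pM (p : {perm node m}) h J : matching (p * Mperm h J * p^-1)%g.
Proof. by apply: matching_conj; exact: Mperm_matching. Qed.

Let gU_ge0 p h I : 0 <= gU p h I. Proof. exact: g_ge0. Qed.
Let gU_le p h I : gU p h I <= alpha. Proof. exact: g_le. Qed.
Let fM_ge0 p h J : 0 <= fM p h J. Proof. exact: f_ge0. Qed.
Let fM_le p h J : fM p h J <= beta. Proof. exact: f_le. Qed.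

(** Expanding the products of masses gives the sums of [g U * f M] over the generated pairs crossing
    3 times, respectively 5 times. *)
Definition weight3 : R :=
  \sum_h \sum_p mass_out (gU p h) None * mass_out (fM p h) None.
Definition weight5 : R :=
  \sum_p mass_in (gU p 0) None * mass_in (fM p 0) None.

Let gU_tau h p i I : gU (p * swapA h i)%g h I = gU p h (tperm None i @^-1: I).
Proof.
rewrite /gU -Uset_swapA; congr g; apply/setP => x.
by rewrite !inE permM.
Qed.

Let fM_tau h p i J : fM (p * swapB h i)%g h J = fM p h (tperm None i @^-1: J).
Proof. by rewrite /fM -Mperm_swapB invMg !mulgA. Qed.

Let outU_tau h p i :
  mass_out (gU (p * swapB h i)%g h) None = mass_out (gU p h) None.
Proof.
apply: eq_bigr => I NI; rewrite /gU -[in RHS](Uset_swapB h i NI); congr g.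
by apply/setP => x; rewrite !inE permM.
Qed.

Let outM_tau h p i :
  mass_out (fM (p * swapA h i)%g h) None = mass_out (fM p h) None.
Proof.
apply: eq_bigr => J NJ; rewrite /fM -[in RHS](Mperm_swapA h i NJ); congr f.
by rewrite invMg !mulgA.
Qed.

Let out_le (G : {set option 'I_m} -> R) (a : R) :
  (forall I, 0 <= G I) -> (forall I, G I <= a) ->
  mass_out G None <= a * 2 ^+ m.+1.
Proof.
move=> G_ge0 G_le; apply: (@le_trans _ _ (mass G)).
  by rewrite (massE G None) lerDr mass_in_ge0.
rewrite /mass (le_trans (ler_sum _ (fun I _ => G_le I))) // sumr_const.
have -> : #|{: {set option 'I_m}}| = (2 ^ m.+1)%N.
  by rewrite -cardsT -powersetT card_powerset cardsT card_option card_ord.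
by rewrite -[leLHS]mulr_natr natrX.
Qed.

(** In [4 ^+ m.+1] one factor [2 ^+ m.+1] is the size of the cube, the other bounds the mass of the
    second function, which serves as weight. *)
Let err : R :=
  #|{perm node m}|%:R * (alpha * beta * 4 ^+ m.+1 * exp (- (delta * m.+1%:R))).

Let card_X : #|{: option 'I_m}| = m.+1.
Proof. by rewrite card_option card_ord. Qed.

Let four_pow : 4 ^+ m.+1 = 2 ^+ m.+1 * 2 ^+ m.+1 :> R.
Proof. by rewrite -exprMn; congr (_ ^+ _); rewrite -natrM. Qed.

Let biasedU p h := (21/20) * mass_in (gU p h) None < mass_out (gU p h) None.
Let biasedM p h := (21/20) * mass_in (fM p h) None < mass_out (fM p h) None.
Let prod3 h p := mass_out (gU p h) None * mass_out (fM p h) None.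

(** [swapA] permutes the coordinates of [gU] and preserves the outer mass of [fM], which may
    therefore be the weight. For [biasedM_small] the roles are exchanged, with [swapB]. *)
Let biasedU_small h :
  \sum_(p | biasedU p h) prod3 h p <= (1/50) * (\sum_p prod3 h p) + err.
Proof.
have := @exchange_biased _ _ None (@swapA m h) (fun p => gU p h)
  (fun p => mass_out (fM p h) None) alpha (beta * 2 ^+ m.+1) delta
  (fun p I => gU_ge0 p h I) (fun p I => gU_le p h I)
  (fun p => mass_out_ge0 (fM_ge0 p h) None)
  (fun p => out_le (fM_ge0 p h) (fM_le p h))
  (gU_tau h) (outM_tau h) delta_small.
move/le_trans; apply; rewrite lerD2l card_X /err le_eqVlt; apply/orP; left.
by apply/eqP; rewrite four_pow; ring.
Qed.

Let biasedM_small h :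
  \sum_(p | biasedM p h) prod3 h p <= (1/50) * (\sum_p prod3 h p) + err.
Proof.
have := @exchange_biased _ _ None (@swapB m h) (fun p => fM p h)
  (fun p => mass_out (gU p h) None) beta (alpha * 2 ^+ m.+1) delta
  (fun p I => fM_ge0 p h I) (fun p I => fM_le p h I)
  (fun p => mass_out_ge0 (gU_ge0 p h) None)
  (fun p => out_le (gU_ge0 p h) (gU_le p h))
  (fM_tau h) (outU_tau h) delta_small.
rewrite /prod3; under eq_bigr do rewrite mulrC.
under [X in _ <= _ * X + _]eq_bigr do rewrite mulrC.
move/le_trans; apply; rewrite lerD2l card_X /err le_eqVlt; apply/orP; left.
by apply/eqP; rewrite four_pow; ring.
Qed.

Let good h p := ~~ biasedU p h && ~~ biasedM p h.

(** Without bias the outer masses are at most [21/20] times the inner ones, which do not depend on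
    [h]; the pentagon then leaves two of the five terms. *)
Let good_le p :
  \sum_(h | good h p) prod3 h p
  <= 2 * ((21/20) * (21/20) * (mass_in (gU p 0) None * mass_in (fM p 0) None)).
Proof.
have in_gU h : mass_in (gU p h) None = mass_in (gU p 0) None.
  by apply: eq_bigr => I NI; rewrite /gU (Uset_in h 0 NI).
have in_fM h : mass_in (fM p h) None = mass_in (fM p 0) None.
  by apply: eq_bigr => I NI; rewrite /fM (Mperm_in h 0 NI).
have a_ge0 := mass_in_ge0 (gU_ge0 p 0) None.
have b_ge0 := mass_in_ge0 (fM_ge0 p 0) None.
have q_ge0 : 0 <= (21/20) * (21/20) * (mass_in (gU p 0) None * mass_in (fM p 0) None).
  by rewrite !mulr_ge0 //; lra.
rewrite big_mkcond; apply: pentagon_sum => // h.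
  case: ifP => // /andP[]; rewrite /biasedU /biasedM in_gU in_fM -!leNgt => hU hM.
  by rewrite mulrACA ler_pM // mass_out_ge0.
(* All pairs in this product cross once. So one of the two masses vanishes, and with it the term at
   [h] or the term at [h + 2]. *)
have cross0 : mass_out (gU p h) None * mass_out (fM p (h + 2)) None = 0.
  rewrite /mass_out mulr_suml big1 // => I NI; rewrite mulr_sumr big1 // => J NJ.
  by apply: gf0 => //; rewrite cross_preim cross1.
have := mass_out_ge0 (fM_ge0 p h) None; have := mass_out_ge0 (gU_ge0 p (h + 2)) None.
move/eqP: cross0; rewrite mulf_eq0 /prod3 => /orP[] /eqP->.
  by rewrite mul0r; left; case: ifP.
by rewrite mulr0; right; case: ifP.
Qed.

(** Each frame is biased on one side or good. For each of five [h], two biased parts cost a share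
    [1/50] and one [err] each, hence the factors [96/100] and 10. *)
Lemma weight3_le : (96/100) * weight3 <= 2 * ((21/20) * (21/20) * weight5) + 10 * err.
Proof.
have split3 h p : prod3 h p <= (if biasedU p h then prod3 h p else 0)
    + (if biasedM p h then prod3 h p else 0) + (if good h p then prod3 h p else 0).
  have : 0 <= prod3 h p by rewrite mulr_ge0 // mass_out_ge0.
  by rewrite /good; case: (biasedU p h); case: (biasedM p h) => /=; lra.
have step h : \sum_p prod3 h p <= (1/25) * (\sum_p prod3 h p) + 2 * err
    + \sum_(p | good h p) prod3 h p.
  have : \sum_p prod3 h p <= \sum_(p | biasedU p h) prod3 h p
      + \sum_(p | biasedM p h) prod3 h p + \sum_(p | good h p) prod3 h p.
    rewrite [X in X + _ + _]big_mkcond [X in _ + X + _]big_mkcond [X in _ + X]big_mkcond.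
    by rewrite -!big_split; apply: ler_sum => p _; exact: split3.
  have := biasedU_small h; have := biasedM_small h; lra.
have : \sum_h \sum_(p | good h p) prod3 h p <= 2 * ((21/20) * (21/20) * weight5).
  under eq_bigr do rewrite big_mkcond.
  rewrite exchange_big /= /weight5 !mulr_sumr; apply: ler_sum => p _.
  by rewrite -big_mkcond; exact: good_le.
have : weight3 <= (1/25) * weight3 + 10 * err + \sum_h \sum_(p | good h p) prod3 h p.
  have -> : 10 * err = \sum_(h < 5) 2 * err.
    by rewrite sumr_const card_ord -mulr_natl; ring.
  by rewrite /weight3 mulr_sumr -!big_split; apply: ler_sum => h _; exact: step.
lra.
Qed.

End RankOne.

(** * Nonnegative rank of the matching slack matrix *)

Lemma card_None_notin (m : nat) :
  #|[pred I : {set option 'I_m} | None \notin I]| = (2 ^ m)%N.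
Proof.
have -> : #|[pred I : {set option 'I_m} | None \notin I]|
    = #|powerset (~: [set None : option 'I_m])|.
  by apply: eq_card => I; rewrite !inE subsetC sub1set inE.
by rewrite card_powerset cardsCs setCK cards1 card_option card_ord subn1.
Qed.

Lemma card_None_in (m : nat) :
  #|[pred I : {set option 'I_m} | None \in I]| = (2 ^ m)%N.
Proof.
have cX : #|{: {set option 'I_m}}| = (2 * 2 ^ m)%N.
  by rewrite -cardsT -powersetT card_powerset cardsT card_option card_ord expnS.
apply/eqP; rewrite -(eqn_add2r (2 ^ m)) -[in X in X == _](card_None_notin m).
by rewrite addnn -mul2n -cX -(cardC [pred I : {set option 'I_m} | None \in I]).
Qed.

(* The separating functional is [weight3 - 2.3 * weight5]: up to a common factor
   it is about [10 - 9.2] on the slack matrix, and exponentially small on every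
   bounded nonnegative rank-one term. *)
Lemma matching_slack_rank (m : nat) (F : finType)
    (g : F -> {set node m} -> R) (f : F -> {perm node m} -> R) (delta : R) :
  (forall r (U : {set node m}), odd #|U| -> 0 <= g r U) ->
  (forall r (M : {perm node m}), matching M -> 0 <= f r M) ->
  (forall (U : {set node m}) (M : {perm node m}), odd #|U| -> matching M ->
     \sum_r g r U * f r M = (cross U M)%:R - 1) ->
  0 <= delta <= 1/(300 * 100 * 100) ->
  exp (delta * m.+1%:R) <= 60 * (#|F|%:R * (6 * m + 10)%:R).
Proof.
move=> g_ge0 f_ge0 gfE delta_small.
pose U0 := @Uset m 0 set0; pose M0 := @Mperm m 0 set0.
have U0odd : odd #|U0| by exact: odd_Uset.
have M0mat : matching M0 by exact: Mperm_matching.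
pose P : {pred {perm node m}} := fun M => [forall x, (M x != x) && (M (M x) == x)].
have matP (M : {perm node m}) : reflect (matching M) (P M).
  apply: (iffP forallP) => H x; first by case/andP: (H x) => ? /eqP.
  by case: (H x) => -> ->; rewrite eqxx.
(* The maxima of each factor serve as [alpha] and [beta] for its term. *)
pose Ur r := [arg max_(U > U0 | odd #|pred_of_set U|) g r U]%O.
pose Mr r := [arg max_(M > M0 | P M) f r M]%O.
have UrP r : odd #|Ur r| /\ forall U : {set node m}, odd #|U| -> g r U <= g r (Ur r).
  by rewrite /Ur; case: arg_maxP.
have MrP r : matching (Mr r) /\ forall M : {perm node m}, matching M -> f r M <= f r (Mr r).
  rewrite /Mr; case: arg_maxP => [|M /matP MP Mle]; first exact/matP.
  by split=> // M' /matP; exact: Mle.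
pose a r := g r (Ur r); pose b r := f r (Mr r).
have term_le r (U : {set node m}) (M : {perm node m}) : odd #|U| -> matching M ->
    g r U * f r M <= (cross U M)%:R - 1.
  move=> oU mM; rewrite -gfE // (bigD1 r) //= lerDl sumr_ge0 // => i _.
  by rewrite mulr_ge0 ?g_ge0 ?f_ge0.
(* The product of the maxima is itself a term of the slack at one pair, so it is at most the number
   of nodes. *)
have ab_le r : a r * b r <= (6 * m + 10)%:R.
  apply: le_trans (term_le r _ _ (UrP r).1 (MrP r).1) _.
  rewrite lerBlDr (@le_trans _ _ (6 * m + 10)%:R) ?lerDl // ler_nat -card_node.
  exact: max_card.
have gf0 r (U : {set node m}) (M : {perm node m}) :
    odd #|U| -> matching M -> cross U M = 1%N -> g r U * f r M = 0.
  move=> oU mM cr; apply/le_anti; rewrite mulr_ge0 ?g_ge0 ?f_ge0 // andbT.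
  by have := term_le r U M oU mM; rewrite cr subrr.
have w_le r := weight3_le (g_ge0 r) (UrP r).2 (f_ge0 r) (MrP r).2 (gf0 r) delta_small.
pose N : R := #|{perm node m}|%:R * (2 ^+ m * 2 ^+ m).
have count (S : pred {set option 'I_m}) (H : R) : #|S| = (2 ^ m)%N ->
    \sum_(I | S I) \sum_(J | S J) H = 2 ^+ m * 2 ^+ m * H.
  move=> cS; under eq_bigr do rewrite sumr_const cS.
  by rewrite sumr_const cS -!natrX -mulrA !mulr_natl.
have odd_p (p : {perm node m}) h I : odd #|p @^-1: Uset h I|.
  by rewrite card_preimset ?odd_Uset //; exact: perm_inj.
have mat_p (p : {perm node m}) h J : matching (p * Mperm h J * p^-1)%g.
  by apply: matching_conj; exact: Mperm_matching.
have sum3 : \sum_r weight3 (g r) (f r) = 10 * N.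
  rewrite /weight3 exchange_big /=.
  transitivity (\sum_(h < 5) (N * 2)); last by rewrite sumr_const card_ord -mulr_natl; ring.
  apply: eq_bigr => h _; rewrite exchange_big /=.
  transitivity (\sum_(p : {perm node m}) (2 ^+ m * 2 ^+ m * 2 : R)); last first.
    by rewrite sumr_const -[LHS]mulr_natl /N; ring.
  apply: eq_bigr => p _; rewrite -(count _ _ (card_None_notin m)).
  rewrite /mass_out; under eq_bigr do rewrite mulr_suml.
  rewrite exchange_big; apply: eq_bigr => I NI /=.
  under eq_bigr do rewrite mulr_sumr.
  rewrite exchange_big; apply: eq_bigr => J NJ /=.
  by rewrite gfE // cross_preim cross3 //; lra.
have sum5 : \sum_r weight5 (g r) (f r) = 4 * N.
  rewrite /weight5 exchange_big /=.
  transitivity (\sum_(p : {perm node m}) (2 ^+ m * 2 ^+ m * 4 : R)); last first.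
    by rewrite sumr_const -[LHS]mulr_natl /N; ring.
  apply: eq_bigr => p _; rewrite -(count _ _ (card_None_in m)).
  rewrite /mass_in; under eq_bigr do rewrite mulr_suml.
  rewrite exchange_big; apply: eq_bigr => I NI /=.
  under eq_bigr do rewrite mulr_sumr.
  rewrite exchange_big; apply: eq_bigr => J NJ /=.
  by rewrite gfE // cross_preim cross5 //; lra.
set E := exp (delta * m.+1%:R).
have E_gt0 : 0 < E by exact: expR_gt0.
have EV : exp (- (delta * m.+1%:R)) = E^-1.
  by apply: (mulfI (lt0r_neq0 E_gt0)); rewrite expRN mulfV // lt0r_neq0.
have N_gt0 : 0 < N.
  rewrite !mulr_gt0 ?exprn_gt0 // ltr0n; apply/card_gt0P; by exists 1%g.
set V : R := (6 * m + 10)%:R.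
(* The 40 is the factor 10 of the error times 4, since [4 ^+ m.+1] is four times
   [2 ^+ m * 2 ^+ m]. *)
have total : (96/100) * (10 * N) <= 2 * ((21/20) * (21/20) * (4 * N))
    + #|F|%:R * (40 * (N * (V * E^-1))).
  rewrite -sum3 -sum5 !mulr_sumr [#|F|%:R * _]mulr_natl -sumr_const -big_split /=.
  apply: ler_sum => r _; apply: le_trans (w_le r) _; rewrite lerD2l EV.
  have -> : 40 * (N * (V * E^-1)) = 40 * N * E^-1 * V by ring.
  have -> : 10 * (#|{perm node m}|%:R * (a r * b r * 4 ^+ m.+1 * E^-1))
      = 40 * N * E^-1 * (a r * b r).
    rewrite /N exprS -exprMn (_ : 2 * 2 = 4 :> R); last by rewrite -natrM.
    ring.
  apply: ler_wpM2l; last exact: ab_le.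
  by rewrite ltW // divr_gt0 // mulr_gt0.
(* Here [9.6 - 8.82 = 0.78] exceeds [3/4]; the final factor [40 / (3/4)] is below 60. *)
have : N * (3/4) <= N * (40 * (#|F|%:R * V * E^-1)) by lra.
rewrite ler_pM2l // => {total}; rewrite -(ler_pM2r E_gt0).
rewrite -!mulrA mulVf ?lt0r_neq0 // mulr1; lra.
Qed.

(** * Farkas' lemma *)

Lemma separate_reals (I : finType) (lo hi : {pred I}) (l u : I -> R) :
  (forall i j, lo i -> hi j -> l i <= u j) ->
  exists t, (forall i, lo i -> l i <= t) /\ (forall j, hi j -> t <= u j).
Proof.
move=> lu; have [i0 lo_i0 | no_lo] := pickP lo.
  exists (l [arg max_(i > i0 | lo i) l i]%O); case: arg_maxP => // i lo_i l_max.
  by split=> [|j hi_j]; [exact: l_max | exact: lu].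
have [j0 hi_j0 | no_hi] := pickP hi; last first.
  by exists 0; split=> i; rewrite ?no_lo ?no_hi.
exists (u [arg min_(j < j0 | hi j) u j]%O); case: arg_minP => // j hi_j u_min.
by split=> [i|]; [rewrite no_lo | exact: u_min].
Qed.

(* Fourier-Motzkin elimination of the last variable; unpaired or trivial pairs
   contribute the zero constraint. *)
Lemma infeasible_certificate (k : nat) (I : finType) (A : I -> nat -> R) (b : I -> R) :
  ~ (exists x : nat -> R, forall i, \sum_(j < k) A i j * x j <= b i) ->
  exists lam : I -> R, [/\ forall i, 0 <= lam i,
    forall j, (j < k)%N -> \sum_i lam i * A i j = 0 & \sum_i lam i * b i < 0].
Proof.
elim: k I A b => [|k IHk] I A b infeas.
  have [i bi] : exists i, b i < 0.
    apply: contra_notP infeas => /forallNP nb; exists (fun=> 0) => i.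
    by rewrite big_ord0 leNgt; apply/negP; exact: nb.
  exists (fun j => (j == i)%:R); split=> [j|//|]; first exact: ler0n.
  rewrite (bigD1 i) //= eqxx mul1r big1 ?addr0 // => j /negbTE->.
  by rewrite mul0r.
pose W (e : I * I) (i : I) : R :=
  if A e.1 k == 0 then (i == e.1)%:R
  else if (0 < A e.1 k) && (A e.2 k < 0) then
    - A e.2 k * (i == e.1)%:R + A e.1 k * (i == e.2)%:R
  else 0.
have W_ge0 e i : 0 <= W e i.
  rewrite /W; case: ifP => _; first exact: ler0n.
  case: ifP => // /andP[pos neg].
  by rewrite addr_ge0 // mulr_ge0 ?ler0n ?oppr_ge0 ?ltW.
have pick_i (F : I -> R) i0 : \sum_i (i == i0)%:R * F i = F i0.
  rewrite (bigD1 i0) //= eqxx mul1r big1 ?addr0 // => i /negbTE->.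
  by rewrite mul0r.
have sumW e (F : I -> R) : \sum_i W e i * F i =
    if A e.1 k == 0 then F e.1
    else if (0 < A e.1 k) && (A e.2 k < 0) then - A e.2 k * F e.1 + A e.1 k * F e.2
    else 0.
  rewrite /W; case: ifP => _; first exact: pick_i.
  case: ifP => _; last by rewrite big1 // => i _; rewrite mul0r.
  under eq_bigr do rewrite mulrDl -!mulrA.
  by rewrite big_split /= -!mulr_sumr !pick_i.
pose A' e j := \sum_i W e i * A i j.
pose b' e := \sum_i W e i * b i.
have A'k e : A' e k = 0.
  rewrite /A' sumW; case: eqP => // _; case: ifP => // _; ring.
(* If the reduced system is infeasible, its certificate is pulled back through [W]; a solution [x]
   of it would extend by a value [t] of the eliminated variable. *)
have [[x x_feas] | infeas'] := pselect (exists x : nat -> R, forall e,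
    \sum_(j < k) A' e j * x j <= b' e); last first.
  have [lam [lam_ge0 lamA lamb]] := IHk _ _ _ infeas'.
  exists (fun i => \sum_e lam e * W e i).
  have swap (F : I -> R) : \sum_i (\sum_e lam e * W e i) * F i = \sum_e lam e * \sum_i W e i * F i.
    under eq_bigr do rewrite mulr_suml.
    rewrite exchange_big; apply: eq_bigr => e _; rewrite mulr_sumr.
    by apply: eq_bigr => i _; rewrite mulrA.
  split=> [i|j|]; last by rewrite swap.
    by apply: sumr_ge0 => e _; rewrite mulr_ge0.
  rewrite ltnS leq_eqVlt swap => /orP[/eqP-> | /lamA //].
  by rewrite big1 // => e _; rewrite -/(A' e k) A'k mulr0.
exfalso; apply: infeas.
pose s i := \sum_(j < k) A i j * x j.
have A's e : \sum_(j < k) A' e j * x j = \sum_i W e i * s i.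
  rewrite /A' /s; under eq_bigr do rewrite mulr_suml.
  under [RHS]eq_bigr do rewrite mulr_sumr.
  by rewrite exchange_big; do 2!apply: eq_bigr => ? _; rewrite mulrA.
have lu i j : A i k < 0 -> 0 < A j k ->
    (b i - s i) / A i k <= (b j - s j) / A j k.
  move=> neg pos; have := x_feas (j, i); rewrite A's /b' !sumW /= pos neg gt_eqF //=.
  move=> h; rewrite ler_pdivlMr // mulrAC ler_ndivrMr //; lra.
have [t [t_lo t_hi]] := @separate_reals I [pred i | A i k < 0] [pred i | 0 < A i k] _ _ lu.
exists (fun j => if j == k then t else x j) => i.
rewrite big_ord_recr /= eqxx.
have -> : \sum_(j < k) A i j * (if j == k :> nat then t else x j) = s i.
  by apply: eq_bigr => j _; rewrite ltn_eqF.
have [neg | pos | zero] := ltgtP (A i k) 0.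
- by have := t_lo i neg; rewrite ler_ndivrMr // mulrC; lra.
- by have := t_hi i pos; rewrite ler_pdivlMr // mulrC; lra.
- by have := x_feas (i, i); rewrite A's /b' !sumW /= zero eqxx mul0r addr0.
Qed.

Section Dot.
Variable D : finType.
Implicit Types a x y : vec D.

Lemma dotE a x : dot a x = \sum_d a d * x d.
Proof. by []. Qed.

Lemma dot_lin a x y (u v : R) :
  dot a (fun d => u * x d + v * y d) = u * dot a x + v * dot a y.
Proof.
rewrite !dotE !mulr_sumr -big_split; apply: eq_bigr => d _ /=; ring.
Qed.

Lemma dot_suml (I : finType) (lam : I -> R) (A : I -> vec D) x :
  dot (fun d => \sum_i lam i * A i d) x = \sum_i lam i * dot (A i) x.
Proof.
rewrite dotE; under eq_bigr do rewrite mulr_suml.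
rewrite exchange_big; apply: eq_bigr => i _; rewrite dotE mulr_sumr.
by apply: eq_bigr => d _; rewrite mulrA.
Qed.

Lemma dot_sumr (I : finType) (lam : I -> R) a (p : I -> vec D) :
  dot a (fun d => \sum_i lam i * p i d) = \sum_i lam i * dot a (p i).
Proof.
rewrite dotE; under eq_bigr do rewrite mulr_sumr.
rewrite exchange_big; apply: eq_bigr => i _; rewrite dotE mulr_sumr.
by apply: eq_bigr => d _; rewrite mulrCA.
Qed.

Lemma eq_dotr a x y : x =1 y -> dot a x = dot a y.
Proof. by move=> xy; apply: eq_bigr => d _; rewrite xy. Qed.

Lemma eq_dotl a a' x : a =1 a' -> dot a x = dot a' x.
Proof. by move=> aa; apply: eq_bigr => d _; rewrite aa. Qed.

End Dot.

Lemma farkas (k : nat) (I : finType) (A : I -> vec 'I_k) (b : I -> R)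
    (c : vec 'I_k) (gam : R) :
  (exists x, forall i, dot (A i) x <= b i) ->
  (forall x, (forall i, dot (A i) x <= b i) -> dot c x <= gam) ->
  exists lam : I -> R, [/\ forall i, 0 <= lam i,
    forall d, \sum_i lam i * A i d = c d & \sum_i lam i * b i <= gam].
Proof.
move=> [x0 x0P] c_valid.
(* Homogenize with one more variable [t], and ask for [c x - gam t >= 1]. *)
pose ext (a : vec 'I_k) (t : R) (j : nat) : R := if insub j is Some i then a i else t.
pose row (i : I + bool) : nat -> R :=
  match i with
  | inl i => ext (A i) (- b i)
  | inr true => ext (fun=> 0) (-1)
  | inr false => ext (fun d => - c d) gam
  end.
pose rhs (i : I + bool) : R := if i is inr false then -1 else 0.
have ext_ord a t (j : 'I_k) : ext a t j = a j by rewrite /ext valK.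
have ext_k a t : ext a t k = t by rewrite /ext insubN // ltnn.
have ext_dot a t (x : nat -> R) :
    \sum_(j < k.+1) ext a t j * x j = dot a (fun d => x d) + t * x k.
  by rewrite big_ord_recr /= ext_k; congr (_ + _); apply: eq_bigr => j _; rewrite ext_ord.
have sum_opt (F : I + bool -> R) :
    \sum_i F i = F (inr false) + F (inr true) + \sum_i F (inl i).
  by rewrite big_sumType big_bool /= addrC [F (inr true) + _]addrC.
have [|lam [lam_ge0 lamA lamb]] := @infeasible_certificate k.+1 _ row rhs.
  case=> x xP; pose xv : vec 'I_k := fun d => x d.
  have xA i : dot (A i) xv <= b i * x k.
    by have := xP (inl i); rewrite /= ext_dot -/xv; lra.
  have xt : 0 <= x k.
    have := xP (inr true); rewrite /= ext_dot dotE big1 => [|d _]; first lra.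
    by rewrite mul0r.
  have xc : gam * x k + 1 <= dot c xv.
    have := xP (inr false); rewrite /= ext_dot -/xv.
    have -> : dot (fun d => - c d) xv = - dot c xv.
      by rewrite !dotE -sumrN; apply: eq_bigr => d _; rewrite mulNr.
    lra.
  have [t_gt0 | t_le0] := ltP 0 (x k).
    have := c_valid (fun d => (x k)^-1 * xv d + 0 * xv d) _.
    rewrite dot_lin mul0r addr0 ler_pdivrMl // => h.
    suff : dot c xv <= x k * gam by lra.
    apply: h => i; rewrite dot_lin mul0r addr0 ler_pdivrMl //.
    by rewrite mulrC.
  have t0 : x k = 0 by apply/le_anti; rewrite t_le0.
  (* For [t = 0], [xv] is a recession direction along which [c] grows by at least 1 per unit, so a
     step of length [s] from [x0] exceeds [gam]. *)
  have [s sE] : exists s, s = gam - dot c x0 + 1 by exists (gam - dot c x0 + 1).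
  have s_gt0 : 0 < s by have := c_valid _ x0P; lra.
  have := c_valid (fun d => 1 * x0 d + s * xv d) _.
  rewrite dot_lin => h; suff : 1 * dot c x0 + s * dot c xv <= gam.
    move: xc; rewrite t0 mulr0 add0r => xc.
    have := ler_wpM2l (ltW s_gt0) xc; lra.
  apply: h => i; rewrite dot_lin; have := xA i; rewrite t0 mulr0 => xAi.
  by have := x0P i; have := mulr_ge0_le0 (ltW s_gt0) xAi; lra.
(* Only the row of [c] has a nonzero right-hand side, so its multiplier is positive and can be
   divided out. *)
move: lamb; rewrite sum_opt /= mulr0 big1 => [|i _]; last by rewrite mulr0.
rewrite !addr0 mulrN1 oppr_lt0 => nu_gt0.
exists (fun i => lam (inl i) / lam (inr false)); split=> [i|d|].
- by rewrite divr_ge0 // ltW.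
- have := lamA d (ltn_trans (ltn_ord d) (ltnSn k)); rewrite sum_opt /= !ext_ord mulr0.
  under eq_bigr do rewrite ext_ord.
  move=> e; under eq_bigr do rewrite mulrAC.
  rewrite -mulr_suml; apply: (mulIf (lt0r_neq0 nu_gt0)).
  by rewrite divfK ?lt0r_neq0 //; lra.
- have := lamA k (ltnSn k); rewrite sum_opt /= !ext_k.
  under eq_bigr do rewrite ext_k mulrN.
  rewrite sumrN => e; under eq_bigr do rewrite mulrAC.
  rewrite -mulr_suml ler_pdivrMr //; have := lam_ge0 (inr true); lra.
Qed.

(** * Facets and slack factorizations *)

Section AffineRank.
Variable k : nat.
Implicit Types (S : vec 'I_k -> Prop) (x : vec 'I_k).

(** The leading entry 1 turns affine independence of points into linear independence of rows. *)
Definition hom x : 'rV[R]_(1 + k) := row_mx (const_mx 1) (\row_j x j).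

Definition hom_mx (r : nat) (p : 'I_r -> vec 'I_k) : 'M[R]_(r, 1 + k) :=
  \matrix_(i < r) hom (p i).

Lemma hom_mx_ker (r : nat) (p : 'I_r -> vec 'I_k) (u : 'rV[R]_r) :
  (u *m hom_mx p = 0) <->
  (\sum_i u 0 i = 0 /\ forall d, \sum_i u 0 i * p i d = 0).
Proof.
have E0 : (u *m hom_mx p) 0 (lshift k 0) = \sum_i u 0 i.
  by rewrite mxE; apply: eq_bigr => i _; rewrite mxE row_mxEl mxE mulr1.
have E1 d : (u *m hom_mx p) 0 (rshift 1 d) = \sum_i u 0 i * p i d.
  by rewrite mxE; apply: eq_bigr => i _; rewrite mxE row_mxEr mxE.
split=> [e | [e0 e1]].
  by split=> [|d]; rewrite -?E0 -?E1 e mxE.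
apply/rowP => j; rewrite [RHS]mxE; case: (split_ordP j) => i ->.
  by rewrite (ord1 i) E0.
by rewrite E1.
Qed.

Lemma aff_indepP (r : nat) (p : 'I_r -> vec 'I_k) :
  aff_indep p <-> row_free (hom_mx p).
Proof.
split=> [indep | free lam lam0 lamp i].
  rewrite -kermx_eq0; apply/rowV0P => u /sub_kermxP /hom_mx_ker [u0 up].
  by apply/rowP => i; rewrite mxE; exact: indep u0 up i.
have : (\row_j lam j) *m hom_mx p = 0.
  apply/hom_mx_ker; split=> [|d].
    by rewrite -[RHS]lam0; apply: eq_bigr => j _; rewrite mxE.
  by rewrite -[RHS](lamp d); apply: eq_bigr => j _; rewrite mxE.
rewrite -(mul0mx _ (hom_mx p)) => /(row_free_inj free) /rowP /(_ i).
by rewrite !mxE.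
Qed.

Lemma aff_indep_le (r : nat) (p : 'I_r -> vec 'I_k) : aff_indep p -> (r <= 1 + k)%N.
Proof. by move/aff_indepP/eqP=> <-; exact: rank_leq_col. Qed.

Lemma aff_rank_exists S : exists r, aff_rank S r.
Proof.
pose indep_in r := `[< exists p : 'I_r -> vec 'I_k, (forall i, S (p i)) /\ aff_indep p >].
have ex0 : exists r, indep_in r.
  by exists 0%N; apply/asboolP; exists (fun=> fun=> 0); split=> [[]|? ? ? []].
have ub r : indep_in r -> (r <= 1 + k)%N.
  by move/asboolP => [p [_ /aff_indep_le]].
case: (ex_maxnP ex0 ub) => r /asboolP r_indep r_max; exists r; split=> //.
move=> r' p lt_rr' Sp indep; have : (r' <= r)%N by apply: r_max; apply/asboolP; exists p.
by rewrite leqNgt lt_rr'.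
Qed.

Definition cons_fam (r : nat) x (p : 'I_r -> vec 'I_k) (i : 'I_r.+1) : vec 'I_k :=
  if unlift ord0 i is Some j then p j else x.

Lemma sum_cons_fam (r : nat) x (p : 'I_r -> vec 'I_k) (lam : 'I_r.+1 -> R) d :
  \sum_i lam i * cons_fam x p i d =
  lam ord0 * x d + \sum_i lam (lift ord0 i) * p i d.
Proof.
rewrite big_ord_recl /cons_fam unlift_none; congr (_ + _).
by apply: eq_bigr => i _; rewrite liftK.
Qed.

(** Otherwise adding [x] would give a longer affinely independent family in [S]. *)
Lemma hom_sub_span S r (p : 'I_r -> vec 'I_k) x :
  aff_rank S r -> (forall i, S (p i)) -> aff_indep p -> S x ->
  (hom x <= hom_mx p)%MS.
Proof.
move=> [_ r_max] Sp indep Sx; apply/negPn/negP => notin.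
apply: (r_max _ (cons_fam x p) (ltnSn r)).
  by move=> i; rewrite /cons_fam; case: unlift.
move=> lam lam0 lamp.
have {}lam0 : lam ord0 + \sum_(i < r) lam (lift ord0 i) = 0.
  by rewrite -[RHS]lam0 [RHS]big_ord_recl.
have lamp' d : lam ord0 * x d + \sum_i lam (lift ord0 i) * p i d = 0.
  by rewrite -sum_cons_fam; exact: lamp.
have l0 : lam ord0 = 0.
  apply/eqP; apply: contraNT notin => l0.
  pose u : 'rV[R]_r := \row_i (- (lam (lift ord0 i) / lam ord0)).
  suff -> : hom x = u *m hom_mx p by exact: submxMl.
  apply/rowP => j; rewrite [RHS]mxE; case: (split_ordP j) => i ->.
    rewrite row_mxEl mxE; under eq_bigr do rewrite mxE [hom_mx _ _ _]mxE row_mxEl mxE mulr1.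
    rewrite sumrN -mulr_suml; apply: (mulIf l0); rewrite mulNr divfK //.
    by rewrite mul1r; apply/eqP; rewrite -addr_eq0; apply/eqP.
  rewrite row_mxEr mxE; under eq_bigr do rewrite mxE [hom_mx _ _ _]mxE row_mxEr mxE mulNr mulrAC.
  rewrite sumrN -mulr_suml; apply: (mulIf l0); rewrite mulNr divfK //.
  by rewrite mulrC; apply/eqP; rewrite -addr_eq0; apply/eqP.
move=> i; case: (unliftP ord0 i) => [j ->|-> //].
apply: indep (fun i => lam (lift ord0 i)) _ _ j.
  by rewrite -[RHS]lam0 l0 add0r.
by move=> d; rewrite -[RHS](lamp' d) l0 mul0r add0r.
Qed.

(** The point [z] off the hyperplane extends an independent family of the section; conversely every
    family in [S] lies in a span of [r] rows and [hom z]. *)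
Lemma aff_rank_succ S (a : vec 'I_k) (beta : R) (z : vec 'I_k) r :
  S z -> dot a z != beta ->
  aff_rank (fun x => S x /\ dot a x = beta) r ->
  (forall (n : nat) (p : 'I_n -> vec 'I_k),
     (forall x, S x /\ dot a x = beta -> (hom x <= hom_mx p)%MS) ->
     forall q, S q -> (hom q <= hom_mx p + hom z)%MS) ->
  aff_rank S r.+1.
Proof.
move=> Sz az rankF span; have [[p [Fp indep]] _] := rankF; split.
  exists (cons_fam z p); split.
    by move=> i; rewrite /cons_fam; case: unlift => [j|] //; case: (Fp j).
  move=> lam lam0 lamp.
  have {}lam0 : lam ord0 + \sum_(i < r) lam (lift ord0 i) = 0.
    by rewrite -[RHS]lam0 [RHS]big_ord_recl.
  have dot0 : \sum_i lam i * dot a (cons_fam z p i) = 0.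
    rewrite -dot_sumr dotE big1 // => d _.
    by rewrite [X in _ * X]lamp mulr0.
  move: dot0; rewrite big_ord_recl [cons_fam _ _ ord0]/cons_fam unlift_none.
  have -> : \sum_(i < r) lam (lift ord0 i) * dot a (cons_fam z p (lift ord0 i))
      = beta * \sum_(i < r) lam (lift ord0 i).
    rewrite mulr_sumr; apply: eq_bigr => i _.
    by rewrite /cons_fam liftK (Fp i).2 mulrC.
  move=> dot0.
  have l0 : lam ord0 = 0.
    have : lam ord0 * (dot a z - beta) = 0.
      have e : \sum_(i < r) lam (lift ord0 i) = - lam ord0.
        by apply/eqP; rewrite -addr_eq0 addrC; apply/eqP.
      by move: dot0; rewrite e; lra.
    by move/eqP; rewrite mulf_eq0 subr_eq0 (negbTE az) orbF => /eqP.
  move=> i; case: (unliftP ord0 i) => [j ->|-> //].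
  apply: indep (fun i => lam (lift ord0 i)) _ _ j.
    by rewrite -[RHS]lam0 l0 add0r.
  by move=> d; rewrite -[RHS](lamp d) [RHS]sum_cons_fam l0 mul0r add0r.
move=> n q lt_n Sq /aff_indepP /eqP free.
have : (hom_mx q <= hom_mx p + hom z)%MS.
  apply/row_subP => i; rewrite rowK; apply: span => // x Fx.
  exact: hom_sub_span rankF Fp indep Fx.
move/mxrankS; rewrite free => le_n.
have := leq_trans le_n (mxrank_adds_leqif _ _).1.
have := rank_leq_row (hom_mx p); have := rank_leq_row (hom z); lia.
Qed.

End AffineRank.

(** * Irredundant systems and their facets *)

Lemma small_step (I : finType) (s d : I -> R) :
  (forall i, 0 < s i) -> exists2 t, 0 < t & forall i, t * d i <= s i.
Proof.
move=> s_gt0.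
suff [t t_gt0 tP] : exists2 t, 0 < t & forall i, i \in enum I -> t * d i <= s i.
  by exists t => // i; apply: tP; rewrite mem_enum.
elim: (enum I) => [|i l [t t_gt0 tP]]; first by exists 1.
have den_gt0 : 0 < `|d i| + 1 by rewrite ltr_wpDl.
exists (Num.min t (s i / (`|d i| + 1))).
  by rewrite lt_min t_gt0 divr_gt0.
have min_gt0 : 0 < Num.min t (s i / (`|d i| + 1)) by rewrite lt_min t_gt0 divr_gt0.
have scale (j : I) c : 0 < c -> Num.min t (s i / (`|d i| + 1)) <= c ->
    c * d j <= s j -> Num.min t (s i / (`|d i| + 1)) * d j <= s j.
  move=> c_gt0 le_c cd; have [d_ge0|/ltW d_le0] := leP 0 (d j).
    exact: le_trans (ler_wpM2r d_ge0 le_c) cd.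
  exact: le_trans (mulr_ge0_le0 (ltW min_gt0) d_le0) (ltW (s_gt0 j)).
move=> j; rewrite in_cons => /orP[/eqP-> | /tP]; last first.
  by apply: scale => //; rewrite ge_min lexx.
apply: (scale i (s i / (`|d i| + 1))); rewrite ?divr_gt0 ?ge_min ?lexx ?orbT //.
rewrite mulrAC ler_pdivrMr //; apply: ler_wpM2l; first exact: ltW.
by rewrite (le_trans (ler_norm _)) // lerDl.
Qed.

Section Irredundant.
Variables (k m : nat) (A : 'I_m -> vec 'I_k) (b : 'I_m -> R).
Variable Q : vec 'I_k -> Prop.
Hypothesis QP : forall x, Q x <-> forall i, dot (A i) x <= b i.

Definition implicit_eq (i : 'I_m) : bool := `[< forall x, Q x -> dot (A i) x = b i >].

Definition sol (K : {set 'I_m}) (x : vec 'I_k) : Prop :=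
  forall i, implicit_eq i || (i \in K) -> dot (A i) x <= b i.

(** Every constraint that is not an implicit equation is strict somewhere on [Q], and midpoints keep
    strictness; this yields a relative interior point. *)
Lemma strict_point : (exists x, Q x) ->
  exists2 z, Q z & forall i, ~~ implicit_eq i -> dot (A i) z < b i.
Proof.
move=> [x0 Qx0].
suff [z Qz zP] : exists2 z, Q z &
    forall i, i \in enum 'I_m -> ~~ implicit_eq i -> dot (A i) z < b i.
  by exists z => // i; apply: zP; rewrite mem_enum.
elim: (enum 'I_m) => [|i l [z Qz zP]]; first by exists x0.
have [imp | nimp] := boolP (implicit_eq i).
  exists z => // j; rewrite in_cons => /orP[/eqP-> | /zP //].
  by rewrite imp.
have [y Qy yi] : exists2 y, Q y & dot (A i) y < b i.
  apply: contrapT => no; move/asboolP: nimp; apply => x Qx.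
  apply/eqP; rewrite eq_le (QP x).1 //= leNgt; apply/negP => lt_x.
  by apply: no; exists x.
exists (fun d => (1/2) * z d + (1/2) * y d).
  by apply/QP => j; rewrite dot_lin; have := (QP z).1 Qz j; have := (QP y).1 Qy j; lra.
move=> j; rewrite in_cons dot_lin => /orP[/eqP-> _|jl nj].
  by have := (QP z).1 Qz i; lra.
by have := zP j jl nj; have := (QP y).1 Qy j; lra.
Qed.

Variable K : {set 'I_m}.
Hypothesis K_nimp : forall i, i \in K -> ~~ implicit_eq i.
Hypothesis solK : forall x, sol K x -> Q x.
Hypothesis K_irr : forall i, i \in K -> exists x, sol (K :\ i) x /\ ~ Q x.
Hypothesis Q_ne : exists x, Q x.

Definition tight i (x : vec 'I_k) : Prop := Q x /\ dot (A i) x = b i.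

(** By irredundancy some point violates constraint [i] alone; the segment to it from a strict point
    meets the hyperplane of [i] at the required point. *)
Lemma tight_point i : i \in K -> exists2 y, tight i y &
  forall j, j \in K :\ i -> dot (A j) y < b j.
Proof.
move=> iK; have [z Qz zP] := strict_point Q_ne.
have [x [xK nQx]] := K_irr iK.
have xi : b i < dot (A i) x.
  rewrite ltNge; apply/negP => le_x; apply: nQx; apply: solK => j jK.
  by have [-> //|ne] := eqVneq j i; apply: xK; rewrite !inE ne.
have zi := zP i (K_nimp iK).
have den : 0 < dot (A i) x - dot (A i) z by lra.
have [t [t_gt0 t_lt1 tE]] : exists t, [/\ 0 < t, t < 1 &
    t * (dot (A i) x - dot (A i) z) = b i - dot (A i) z].
  exists ((b i - dot (A i) z) / (dot (A i) x - dot (A i) z)); split.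
  - by rewrite divr_gt0 // subr_gt0.
  - by rewrite ltr_pdivrMr // mul1r ltrD2r.
  - by rewrite divfK // gt_eqF.
pose y : vec 'I_k := fun d => (1 - t) * z d + t * x d.
have yi : dot (A i) y = b i by rewrite dot_lin; lra.
have h2 j : implicit_eq j || (j \in K :\ i) -> t * dot (A j) x <= t * b j.
  by move=> jP; rewrite ler_pM2l // xK.
have yK j : j \in K :\ i -> dot (A j) y < b j.
  move=> jKi; rewrite dot_lin; have /setD1P[_ jK] := jKi.
  have h1 : (1 - t) * dot (A j) z < (1 - t) * b j.
    by rewrite ltr_pM2l ?subr_gt0 // zP // K_nimp.
  have := h2 j; rewrite jKi orbT => /(_ isT); lra.
exists y => //; split=> //; apply: solK => j /orP[jE|jK].
  have := h2 j; rewrite jE => /(_ isT); rewrite dot_lin (asboolW jE z Qz); lra.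
have [->|ne] := eqVneq j i; first by rewrite yi.
by apply/ltW/yK; rewrite !inE ne.
Qed.

(** For [q] in [Q], a multiple of [z - y] is subtracted from [q - y] to get a vector [v] parallel to
    the hyperplane. A small step along [v] from [y] stays in the face, so [q] is an affine
    combination of two points of the face and [z]. *)
Lemma tight_facet i : i \in K -> facet Q (tight i).
Proof.
move=> iK; split.
  by exists (A i), (b i); split=> // x /QP /(_ i) /RleP.
have [r rankF] := aff_rank_exists (tight i); exists r; split=> //.
have [z Qz zP] := strict_point Q_ne.
have [y [Qy yi] yP] := tight_point iK.
have zi := zP i (K_nimp iK).
apply: (aff_rank_succ Qz _ rankF); first by rewrite lt_eqF.
move=> n p spanF q Qq.
have [th thE] : exists th, th * (b i - dot (A i) z) = b i - dot (A i) q.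
  exists ((b i - dot (A i) q) / (b i - dot (A i) z)).
  by rewrite divfK // gt_eqF // subr_gt0.
pose v : vec 'I_k := fun d => 1 * (q d - y d) + (- th) * (z d - y d).
have dotB a (x x' : vec 'I_k) : dot a (fun d => x d - x' d) = dot a x - dot a x'.
  by rewrite !dotE -sumrB; apply: eq_bigr => d _; rewrite mulrBr.
have vE a : dot a v = dot a q - dot a y - th * (dot a z - dot a y).
  by rewrite dot_lin !dotB; ring.
have s_gt0 j : 0 < (if j \in K :\ i then b j - dot (A j) y else 1).
  by case: ifP => // jK; rewrite subr_gt0 yP.
have [t t_gt0 tP] :=
  small_step (fun j => if j \in K :\ i then dot (A j) v else 0) s_gt0.
pose q' : vec 'I_k := fun d => 1 * y d + t * v d.
have q'i : dot (A i) q' = b i.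
  have e : dot (A i) q - b i - th * (dot (A i) z - b i) = 0 by lra.
  by rewrite dot_lin vE yi e mulr0 addr0 mul1r.
have Fq' : tight i q'.
  split=> //; apply: solK => j /orP[/asboolP jE|jK].
    by rewrite dot_lin vE !jE // subrr mulr0 subr0 mulr0 addr0 mul1r.
  have [->|ne] := eqVneq j i; first by rewrite q'i.
  have := tP j; rewrite !inE ne jK /= => tj; rewrite dot_lin; lra.
have t_neq0 : t != 0 by rewrite gt_eqF.
have -> : hom q = (t^-1 *: hom q' + (1 - t^-1 - th) *: hom y) + th *: hom z.
  have combE (u v' w : 'rV[R]_(1 + k)) c1 c2 c3 j :
      ((c1 *: u + c2 *: v') + c3 *: w) 0 j = c1 * u 0 j + c2 * v' 0 j + c3 * w 0 j.
    by rewrite !mxE.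
  apply/rowP => j; rewrite combE; case: (split_ordP j) => e ->.
    by rewrite !row_mxEl !mxE; ring.
  by rewrite !row_mxEr !mxE /q' /v; field; exact: t_neq0.
apply: addmx_sub_adds; last exact: scalemx_sub.
by apply: addmx_sub; apply: scalemx_sub; apply: spanF.
Qed.

(** Distinct indices give distinct facets, since the point tight at one index is strict at every
    other. *)
Lemma card_irredundant_le f : num_facets Q f -> (#|K| <= f)%N.
Proof.
move=> [Fs [_ [_ Fs_all]]].
have /choice[phi phiP] : forall i : {i | i \in K},
    exists j : 'I_f, same_set (tight (val i)) (Fs j).
  by move=> i; exact/Fs_all/tight_facet/(valP i).
rewrite -[X in (_ <= X)%N]card_ord -card_sig; apply: (@leq_card _ _ phi) => i j eq_phi.
apply/val_inj/eqP; apply: contraT => ne.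
have [y Fy y_lt] := tight_point (valP i).
have [_ yj] : tight (val j) y by apply/(phiP j); rewrite -eq_phi; apply/(phiP i).
have := y_lt (val j); rewrite !inE eq_sym ne (valP j) yj ltxx.
by move=> /(_ isT).
Qed.

End Irredundant.

(* Only the facets contribute: along implicit equations the slack vanishes. *)
Lemma slack_factorization (k f : nat) (Q : vec 'I_k -> Prop) :
  polyhedron Q -> (exists x, Q x) -> num_facets Q f ->
  exists (F : finType) (sl : F -> vec 'I_k -> R), [/\ (#|F| <= f.+1)%N,
    forall i x, Q x -> 0 <= sl i x &
    forall c gam, (forall x, Q x -> dot c x <= gam) ->
      exists2 lam : F -> R, forall i, 0 <= lam i &
        forall x, Q x -> gam - dot c x = \sum_i lam i * sl i x].
Proof.
move=> [m [A [b QPR]]] Q_ne nf.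
have QP x : Q x <-> forall i, dot (A i) x <= b i.
  by rewrite QPR; split=> xP i; apply/RleP.
pose good (K : {set 'I_m}) :=
  `[< (forall i, i \in K -> ~~ implicit_eq A b Q i) /\ forall x, sol A b Q K x -> Q x >].
pose K0 := [set i | ~~ implicit_eq A b Q i].
have good0 : good K0.
  apply/asboolP; split=> [i|x xK]; first by rewrite inE.
  by apply/QP => i; apply: xK; rewrite inE orbN.
pose K := [arg min_(K < K0 | good K) #|K|].
have [K_nimp solK K_irr] : [/\ forall i, i \in K -> ~~ implicit_eq A b Q i,
    forall x, sol A b Q K x -> Q x &
    forall i, i \in K -> exists x, sol A b Q (K :\ i) x /\ ~ Q x].
  rewrite /K; case: arg_minnP => // {}K /asboolP[K_nimp solK] K_min.
  split=> // i iK; apply: contrapT => no.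
  have : good (K :\ i).
    apply/asboolP; split=> [j /setD1P[_ /K_nimp] //|x xP].
    by apply: contrapT => nQ; apply: no; exists x.
  by move/K_min; rewrite (cardsD1 i K) iK add1n ltnn.
have cardK := card_irredundant_le QP K_nimp solK K_irr Q_ne nf.
pose cond i := implicit_eq A b Q i || (i \in K).
(* Discarded constraints become trivial, which keeps the index type for Farkas' lemma. *)
pose A' i : vec 'I_k := if cond i then A i else fun=> 0.
pose b' i : R := if cond i then b i else 0.
have QP' x : Q x <-> forall i, dot (A' i) x <= b' i.
  split=> [Qx i|xP].
    rewrite /A' /b'; case: ifP => _; first by apply QP.
    by rewrite dotE big1 // => d _; rewrite mul0r.
  by apply: solK => i ci; have := xP i; rewrite /A' /b' /cond ci.
(* The additional constant slack 1 absorbs what Farkas' lemma leaves between the combined right-hand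
   side and [gam]; hence [f.+1]. *)
pose slk (i : 'I_#|K| + 'I_1) (x : vec 'I_k) : R :=
  if i is inl j then b (enum_val j) - dot (A (enum_val j)) x else 1.
exists ('I_#|K| + 'I_1)%type, slk; split.
- by rewrite card_sum !card_ord addn1.
- by move=> [i|i] x Qx //=; rewrite subr_ge0; apply QP.
move=> c gam c_valid.
have [||lam [lam_ge0 lamA lamb]] := @farkas k _ A' b' c gam.
- by have [x Qx] := Q_ne; exists x; apply/QP'.
- by move=> x /QP'; exact: c_valid.
exists (fun i => if i is inl j then lam (enum_val j) else gam - \sum_i lam i * b' i).
  by case=> [j|_] //; rewrite subr_ge0.
move=> x Qx; rewrite big_sumType big_ord1 /= mulr1.
rewrite -(big_enum_val (fun i => lam i * (b i - dot (A i) x))) /=.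
have -> : dot c x = \sum_i lam i * dot (A' i) x.
  by rewrite -dot_suml; apply: eq_dotl.
have -> : \sum_(i in K) lam i * (b i - dot (A i) x)
    = \sum_i lam i * b' i - \sum_i lam i * dot (A' i) x; last by ring.
rewrite -sumrB big_mkcond; apply: eq_bigr => i _; rewrite /A' /b' /cond -mulrBr.
case: ifP => [iK|_]; first by rewrite orbT.
rewrite orbF; case: ifP => [/asboolP-> //|_]; first by rewrite subrr mulr0.
by rewrite dotE big1 ?subrr ?mulr0 // => d _; rewrite mul0r.
Qed.

(** * Cuts and joins *)

Lemma exists_pairing (V : finType) (W : {set V}) : ~~ odd #|W| ->
  exists s : V -> V, forall x, x \in W -> [/\ s x \in W, s x != x & s (s x) = x].
Proof.
have [n] := ubnP #|W|; elim: n W => // n IHn W lt_n evenW.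
have [-> | [a aW]] := set_0Vmem W; first by exists id => x; rewrite inE.
have [W'0 | [b]] := set_0Vmem (W :\ a).
  by move: evenW; rewrite (cardsD1 a) aW W'0 cards0.
rewrite !inE => /andP[ba bW].
have cardW : #|W| = #|W :\ a :\ b|.+2.
  by rewrite (cardsD1 a) aW (cardsD1 b) !inE ba bW.
have [||s sP] := IHn (W :\ a :\ b); first by move: lt_n; rewrite cardW; lia.
  by move: evenW; rewrite cardW /= negbK.
exists (fun x => if x == a then b else if x == b then a else s x) => x xW.
have [->|xa] := eqVneq x a; first by rewrite (negbTE ba) eqxx.
have [->|xb] := eqVneq x b; first by rewrite eqxx eq_sym ba.
have [] := sP x; first by rewrite !inE xa xb.
by rewrite !inE => /and3P[/negbTE-> /negbTE-> ->].
Qed.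

(** One node of each set forms the crossing pair; the remaining even sets are paired internally. *)
Lemma exists_pairing_cross (V : finType) (W1 W2 : {set V}) :
  [disjoint W1 & W2] -> odd #|W1| -> odd #|W2| ->
  exists s : V -> V,
    (forall x, x \in W1 :|: W2 -> [/\ s x \in W1 :|: W2, s x != x & s (s x) = x])
    /\ #|[set x in W1 | s x \notin W1]| = 1%N.
Proof.
move=> dis odd1 odd2.
have [a aW1] : exists a, a \in W1 by apply/card_gt0P; case: #|W1| odd1.
have [b bW2] : exists b, b \in W2 by apply/card_gt0P; case: #|W2| odd2.
have notW2 x : x \in W1 -> x \notin W2.
  by move=> xW1; apply/negP => xW2; move/pred0P: dis => /(_ x) /=; rewrite xW1 xW2.
have ba : b != a by apply: contraTneq bW2 => ->; exact: notW2.
have [s1 s1P] : exists s : V -> V, forall x, x \in W1 :\ a ->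
    [/\ s x \in W1 :\ a, s x != x & s (s x) = x].
  by apply: exists_pairing; move: odd1; rewrite (cardsD1 a) aW1.
have [s2 s2P] : exists s : V -> V, forall x, x \in W2 :\ b ->
    [/\ s x \in W2 :\ b, s x != x & s (s x) = x].
  by apply: exists_pairing; move: odd2; rewrite (cardsD1 b) bW2.
pose s x := if x == a then b else if x == b then a else
  if x \in W1 then s1 x else s2 x.
have sW1 x : x \in W1 -> x != a -> [/\ s x \in W1, s x != x & s (s x) = x].
  move=> xW1 xa; have xb : (x == b) = false.
    by apply: contraTF xW1 => /eqP->; apply: contraTN bW2; exact: notW2.
  have [|] := s1P x; first by rewrite !inE xa.
  rewrite /s (negbTE xa) xb xW1 !inE => /andP[/negbTE-> s1W] -> ->.
  rewrite s1W; case: eqP => // e; by move: (notW2 _ s1W); rewrite e bW2.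
have sW2 x : x \in W2 -> x != b -> [/\ s x \in W2, s x != x & s (s x) = x].
  move=> xW2 xb; have xW1 : (x \in W1) = false by apply: contraTF xW2; exact: notW2.
  have xa : (x == a) = false by apply: contraFF xW1 => /eqP->.
  have [|] := s2P x; first by rewrite !inE xb.
  rewrite /s xa (negbTE xb) xW1 !inE => /andP[/negbTE-> s2W] -> ->.
  have s2W1 : (s2 x \in W1) = false by apply: contraTF s2W; exact: notW2.
  rewrite s2W s2W1; case: eqP => // e; by move: s2W1; rewrite e aW1.
have sa : s a = b by rewrite /s eqxx.
have sb : s b = a by rewrite /s (negbTE ba) eqxx.
exists s; split.
  move=> x; have [-> _|xa] := eqVneq x a; first by rewrite sa sb inE bW2 orbT.
  have [-> _|xb] := eqVneq x b; first by rewrite sb sa inE aW1 eq_sym.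
  rewrite !inE => /orP[xW|xW].
    by have [-> -> ->] := sW1 x xW xa.
  by have [-> -> ->] := sW2 x xW xb; rewrite orbT.
rewrite (_ : [set _ in _ | _] = [set a]) ?cards1 //; apply/setP => x; rewrite !inE.
have [->|xa] := eqVneq x a.
  by rewrite aW1 sa; apply: contraTN bW2; exact: notW2.
by apply/negbTE; rewrite negb_and negbK -implybE; apply/implyP => /sW1 /(_ xa) [].
Qed.

(** * Matching inequalities and the vertices of the dominant *)

Section TJoin.
Variables (n : nat) (T : {set 'I_n}).
Implicit Types (S : {set 'I_n}) (s : 'I_n -> 'I_n).

Definition pairing_on (s : 'I_n -> 'I_n) : Prop :=
  forall x, x \in T -> [/\ s x \in T, s x != x & s (s x) = x].

Definition join_vec (s : 'I_n -> 'I_n) : vec (edge n) :=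
  fun e => if ((val e).1 \in T) && (s (val e).1 == (val e).2) then 1 else 0.

(** A matching edge in the cut has exactly one end in [S], and this end determines the edge. *)
Lemma dot_join_cut s S : pairing_on s ->
  dot (join_vec s) (cut_vec S) = #|[set x in S :&: T | s x \notin S]|%:R.
Proof.
move=> sP.
pose E := [set e : edge n | [&& (val e).1 \in T, s (val e).1 == (val e).2 &
  ((val e).1 \in S) != ((val e).2 \in S)]].
transitivity (#|E|%:R : R).
  rewrite -sum1_card natr_sum [RHS]big_mkcond dotE; apply: eq_bigr => e _.
  rewrite inE /join_vec /cut_vec andbA.
  by case: (_ && _) => /=; rewrite ?mul0r // mul1r; case: ifP.
pose end_in (e : edge n) := if (val e).1 \in S then (val e).1 else (val e).2.
have endsP (e : edge n) : e \in E -> [/\ end_in e \in S :&: T, s (end_in e) \notin S &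
    val e = (end_in e, s (end_in e)) \/ val e = (s (end_in e), end_in e)].
  case: e => -[i j] /= ij; rewrite inE /end_in /= => /and3P[iT /eqP <-].
  have [sT _ ss] := sP i iT.
  by case: ifP => iS; rewrite !inE ?iS ?iT ?sT ?ss ?iS ?andbT;
    case: (s i \in S) => // _; split=> //; [left|right].
rewrite -(card_in_imset (f := end_in)); last first.
  move=> e e' /endsP[_ _ eE] /endsP[_ _ e'E] eq_end; apply/val_inj.
  have := valP e; have := valP e'.
  by case: eE => ->; case: e'E => -> /=; rewrite eq_end //= => lt1 lt2; lia.
congr (#|pred_of_set _|%:R); apply/setP => x; apply/imsetP/idP => [[e /endsP[eST sS _] ->]|].
  by rewrite !inE sS andbT; move: eST; rewrite inE.
rewrite !inE => /andP[/andP[xS xT] sxS]; have [sT sx ss] := sP x xT.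
have [lt_x|lt_s|eq_x] := ltngtP x (s x); last by move: sx; rewrite -(val_inj eq_x) eqxx.
  by exists (exist _ (x, s x) lt_x : edge n); rewrite ?inE /end_in /= ?xS ?xT ?eqxx ?(negbTE sxS).
by exists (exist _ (s x, x) lt_s : edge n); rewrite ?inE /end_in /= ?xS ?sT ?ss ?eqxx ?(negbTE sxS).
Qed.

Lemma odd_join_cut s S : pairing_on s ->
  odd #|[set x in S :&: T | s x \notin S]| = odd #|S :&: T|.
Proof.
move=> sP; rewrite -[in RHS](cardsID [set x | s x \in S] (S :&: T)) oddD.
rewrite [X in _ = X (+) _]negbTE ?addFb.
  by congr (odd #|pred_of_set _|); apply/setP => x; rewrite !inE andbC.
apply: (@even_card_involution _ s) => x; rewrite !inE => /andP[/andP[xS xT] sxS].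
by have [sT sx ss] := sP x xT; rewrite ss xS sxS sT.
Qed.

Lemma cut_in_dom S : odd #|S :&: T| -> Tcut_dom T (cut_vec S).
Proof.
move=> oddS; exists (cut_vec S); split; last by move=> d; exact: Rle_refl.
exists (fun S' => if S' == S then 1 else 0); split; last split; last split.
- by move=> S'; case: ifP => _; apply/RleP.
- by move=> S'; case: eqP => [->|//].
- by rewrite -[LHS]/(\sum_S' (if S' == S then 1 else 0 : R)) -big_mkcond big_pred1_eq.
- move=> d.
  rewrite -[RHS]/(\sum_S' ((if S' == S then 1 else 0 : R) * cut_vec S' d)).
  by rewrite (bigD1 S) //= eqxx mul1r big1 ?addr0 // => S' /negbTE->; rewrite mul0r.
Qed.

(** A pairing of [T] meets each [T]-cut in an odd number of edges, hence at least once; nonnegative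
    entries carry the bound over to the dominant. *)
Lemma join_valid s : pairing_on s ->
  valid_ineq (Tcut_dom T) (fun e => - join_vec s e) (-1).
Proof.
move=> sP x [y [[lam [lam_ge0 [lam0 [lam1 yE]]]] yx]].
have negE (z : vec (edge n)) : dot (fun e => - join_vec s e) z = - dot (join_vec s) z.
  by rewrite !dotE -sumrN; apply: eq_bigr => e _; rewrite mulNr.
apply/RleP; rewrite negE lerN2.
apply: (@le_trans _ _ (dot (join_vec s) y)); last first.
  apply: ler_sum => e _; apply: ler_wpM2l; last exact/RleP/yx.
  by rewrite /join_vec; case: ifP.
rewrite (eq_dotr _ yE) dot_sumr -[leLHS]lam1; apply: ler_sum => S _.
have [oddS | evenS] := boolP (odd #|S :&: T|); last first.
  by rewrite lam0 ?mul0r //; exact/negP.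
rewrite -[leLHS]mulr1; apply: ler_wpM2l; first exact/RleP/lam_ge0.
rewrite dot_join_cut // (ler_nat _ 1) lt0n.
by apply: contraTneq oddS => e0; rewrite -(odd_join_cut S sP) e0.
Qed.

(** The dominant recedes in all coordinate directions, so [a] is nonpositive and [v] equals a point
    of the polytope below it. A cut of nonzero weight in that convex combination is tight too, hence
    equal to [v]. *)
Lemma vertex_cut v : vertex (Tcut_dom T) v ->
  exists S, odd #|S :&: T| /\ v = cut_vec S.
Proof.
move=> [Pv [a [beta [valid [av uniq]]]]].
have a_le0 e : a e <= 0.
  pose w : vec (edge n) := fun e' => 1 * v e' + 1 * (if e' == e then 1 else 0).
  have Pw : Tcut_dom T w.
    have [y [Py yv]] := Pv; exists y; split=> // e'; apply/RleP.
    rewrite /w !mul1r (le_trans (y := v e')) ?lerDl //; first exact/RleP.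
    by case: ifP.
  have := valid w Pw; move/RleP; rewrite dot_lin av !mul1r gerDl.
  rewrite dotE (bigD1 e) //= eqxx mulr1 big1 ?addr0 // => e' /negbTE->.
  by rewrite mulr0.
have [y [Py yv]] := Pv.
have Py' : Tcut_dom T y by exists y; split=> // d; exact: Rle_refl.
have ay : dot a y = beta.
  apply/le_anti/andP; split; first exact/RleP/valid.
  rewrite -av; apply: ler_sum => e _; rewrite ler_wnM2l //; exact/RleP.
have yE := uniq _ Py' ay.
have [lam [lam_ge0 [lam0 [lam1 ycomb]]]] := Py.
have slack0 : \sum_S lam S * (beta - dot a (cut_vec S)) = 0.
  under eq_bigr do rewrite mulrBr.
  rewrite sumrB -mulr_suml -dot_sumr -(eq_dotr a ycomb) ay.
  by rewrite [X in X * _]lam1 mul1r subrr.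
have term_ge0 S : 0 <= lam S * (beta - dot a (cut_vec S)).
  have lamS : 0 <= lam S by exact/RleP.
  have [oddS | evenS] := boolP (odd #|S :&: T|); last first.
    by rewrite lam0 ?mul0r //; exact/negP.
  by rewrite mulr_ge0 // subr_ge0; apply/RleP/valid/cut_in_dom.
have [S lamS] : exists S, lam S != 0.
  apply: contrapT => no; have : \sum_S lam S = 0.
    by apply: big1 => S _; apply/eqP/negPn/negP => lamS; apply: no; exists S.
  by rewrite [LHS]lam1 => /eqP; rewrite oner_eq0.
have oddS : odd #|S :&: T|.
  by apply: contraNT lamS => evenS; rewrite lam0 //; exact/negP.
exists S; split=> //; apply/esym/uniq; first exact: cut_in_dom.
have := psumr_eq0P (fun S _ => term_ge0 S) slack0 (i := S) isT.
by move/eqP; rewrite mulf_eq0 (negbTE lamS) subr_eq0 => /eqP.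
Qed.

End TJoin.

Section Embedding.
Variables (n m : nat) (T S0 : {set 'I_n}).
Hypotheses (T_even : ~~ odd #|T|) (S0_odd : odd #|S0 :&: T|).
Hypothesis room : (6 * m + 10 <= #|S0 :&: T|)%N.

(* Fix an embedding [iota] of the nodes into [S0 :&: T] and a pairing of the
   remaining elements of [T] crossing [S0] once. Every perfect matching of the
   nodes then extends to a pairing of [T] crossing [S0] once. *)
Lemma matching_embedding :
  exists (shore : {set node m} -> {set 'I_n}) (ext : {perm node m} -> 'I_n -> 'I_n),
  [/\ forall U : {set node m}, odd #|U| -> odd #|shore U :&: T|,
      forall M : {perm node m}, matching M -> pairing_on T (ext M),
      forall M : {perm node m}, matching M ->
        #|[set x in S0 :&: T | ext M x \notin S0]| = 1%N &
      forall (U : {set node m}) (M : {perm node m}),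
        #|[set x in shore U :&: T | ext M x \notin shore U]| = cross U M].
Proof.
have card_le : (#|node m| <= #|S0 :&: T|)%N by rewrite card_node.
pose iota (y : node m) : 'I_n := enum_val (widen_ord card_le (enum_rank y)).
have iota_inj : injective iota.
  by move=> y z /enum_val_inj /(congr1 val) /= e; apply/enum_rank_inj/val_inj.
have iotaP y : iota y \in S0 :&: T by exact: enum_valP.
have iotaS y : iota y \in S0 by have := iotaP y; rewrite inE => /andP[].
have iotaT y : iota y \in T by have := iotaP y; rewrite inE => /andP[].
pose y0 := nC m 0 false.
pose inv x := odflt y0 [pick y | iota y == x].
have iotaK : cancel iota inv.
  move=> y; rewrite /inv; case: pickP => [z /eqP /iota_inj //|/(_ y)].
  by rewrite eqxx.
pose V := [set iota y | y in [set: node m]].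
have cardV : #|V| = (6 * m + 10)%N by rewrite card_imset // cardsT card_node.
have iotaV y : iota y \in V by rewrite mem_imset // inE.
have VP x : x \in V -> exists y, x = iota y by case/imsetP => y _ ->; exists y.
have V_sub : V \subset S0 :&: T by apply/subsetP => x /VP[y ->].
(* Both sets are odd because [6 * m + 10] and [#|T|] are even, as needed for a single crossing
   pair. *)
pose W1 := (S0 :&: T) :\: V; pose W2 := T :\: S0.
have odd1 : odd #|W1|.
  by rewrite cardsD (setIidPr V_sub) oddB ?subset_leq_card // S0_odd cardV; lia.
have odd2 : odd #|W2|.
  by move: T_even; rewrite -(cardsID S0 T) setIC oddD S0_odd /= negbK.
have dis : [disjoint W1 & W2].
  by apply/pred0P => x /=; rewrite !inE; case: (x \in S0); rewrite ?andbF.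
have [s [sP s1]] := exists_pairing_cross dis odd1 odd2.
have notV x : x \in W1 :|: W2 -> x \notin V.
  rewrite !inE => /orP[/andP[] //|/andP[xS _]]; apply: contra xS.
  by move/VP => [y ->].
have TW x : x \in T -> x \notin V -> x \in W1 :|: W2.
  by rewrite !inE => -> ->; rewrite andbT /=; case: (x \in S0).
have WT x : x \in W1 :|: W2 -> x \in T.
  by rewrite !inE => /orP[/andP[_ /andP[]]|/andP[]].
pose ext (M : {perm node m}) x := if x \in V then iota (M (inv x)) else s x.
pose shore (U : {set node m}) := [set iota y | y in U].
have ext_iota (M : {perm node m}) y : ext M (iota y) = iota (M y) by rewrite /ext iotaV iotaK.
have shoreT U : shore U :&: T = shore U.
  by apply/setIidPl/subsetP => x /imsetP[y _ ->].
exists shore, ext; split.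
- by move=> U; rewrite shoreT card_imset.
- move=> M matM x xT; have [/VP[y ->]|nV] := boolP (x \in V).
    rewrite !ext_iota; have [neq ->] := matM y; split=> //.
    by rewrite (inj_eq iota_inj).
  have [sW sx ss] := sP x (TW x xT nV).
  by rewrite /ext (negbTE nV) (negbTE (notV _ sW)); split=> //; exact: WT.
- move=> M matM; rewrite -s1; congr #|pred_of_set _|; apply/setP => x.
  rewrite !inE; have [/VP[y ->]|nV] := boolP (x \in V).
    by rewrite ext_iota iotaS andbF.
  rewrite /ext (negbTE nV) /=; have [|] := boolP (x \in S0 :&: T); rewrite inE => xST.
    rewrite xST /=; have /andP[_ xT] := xST.
    have [sW _ _] := sP x (TW x xT nV).
    by rewrite (notV _ sW) (WT _ sW) !andbT.
  by rewrite (negbTE xST).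
- move=> U M; rewrite shoreT /cross -(card_imset _ iota_inj); congr #|pred_of_set _|.
  apply/setP => x; apply/idP/imsetP => [|[y]].
    rewrite inE => /andP[/imsetP[y yU ->]]; rewrite ext_iota mem_imset // => MU.
    by exists y => //; rewrite inE yU.
  by rewrite inE => /andP[yU MU] ->; rewrite inE ext_iota !mem_imset // yU.
Qed.

End Embedding.

(** * The bound for one radial cone *)

Lemma cut_vecC (n : nat) (S : {set 'I_n}) : cut_vec (~: S) = cut_vec S.
Proof.
apply/funext => e; rewrite /cut_vec !inE.
by case: (_ \in S); case: (_ \in S).
Qed.

(** Cuts are lifted to points of [Q] and tight matching inequalities pulled back to [Q]; the slack
    factorization of [Q] then factors the matrix with entries [cross U M - 1]. *)
Lemma radial_cone_xc (n m k f : nat) (T : {set 'I_n}) (v : vec (edge n))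
    (Q : vec 'I_k -> Prop) (L : edge n -> 'I_k -> R) :
  ~~ odd #|T| -> (2 * (6 * m + 10) <= #|T|)%N ->
  vertex (Tcut_dom T) v ->
  linear_extension (radial_cone (Tcut_dom T) v) Q L -> num_facets Q f ->
  exp (1/(300 * 100 * 100) * m.+1%:R) <= 60 * (f.+1%:R * (6 * m + 10)%:R).
Proof.
move=> evenT big_T vert [polyQ QL] nf.
have [S0 [S0_odd vE room]] : exists S0 : {set 'I_n}, [/\ odd #|S0 :&: T|,
    v = cut_vec S0 & (6 * m + 10 <= #|S0 :&: T|)%N].
  have [S [oddS vE]] := vertex_cut vert.
  have cardT : (#|S :&: T| + #|~: S :&: T| = #|T|)%N.
    by rewrite -(cardsID S T) setIC [~: S :&: T]setIC setDE.
  have [le|lt] := leqP (6 * m + 10) #|S :&: T|; first by exists S.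
  exists (~: S); rewrite cut_vecC; split=> //; last by lia.
  by move: evenT; rewrite -cardT oddD oddS /= negbK.
have [shore [ext [shore_odd ext_pair ext_one ext_cross]]] :=
  matching_embedding evenT S0_odd room.
have cut_cone S : odd #|S :&: T| -> radial_cone (Tcut_dom T) v (cut_vec S).
  by move=> oddS a beta valid _; exact/valid/cut_in_dom.
have liftP (S : {set 'I_n}) : exists y, odd #|S :&: T| ->
    Q y /\ cut_vec S =1 linmap L y.
  have [oddS|_] := boolP (odd #|S :&: T|); last by exists (fun=> 0).
  by have [y Qy] := (QL _).1 (cut_cone S oddS); exists y.
have [lift_pt lift_ptP] := choice liftP.
have Q_ne : exists y, Q y by exists (lift_pt S0); exact: (lift_ptP S0 S0_odd).1.
have [F [sl [cardF sl_ge0 slack]]] := slack_factorization polyQ Q_ne nf.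
pose pull (a : vec (edge n)) : vec 'I_k := fun j => \sum_d a d * L d j.
have pullE a y : dot (pull a) y = dot a (linmap L y).
  rewrite dotE; under eq_bigr do rewrite mulr_suml.
  rewrite exchange_big; apply: eq_bigr => d _; rewrite /linmap /=.
  transitivity (a d * (\sum_j L d j * y j)) => //.
  by rewrite mulr_sumr; apply: eq_bigr => j _; rewrite mulrA.
have dotN (a x : vec (edge n)) : dot (fun e => - a e) x = - dot a x.
  by rewrite !dotE -sumrN; apply: eq_bigr => e _; rewrite mulNr.
have lamP (M : {perm node m}) : exists lam : F -> R, matching M ->
    (forall i, 0 <= lam i) /\ forall y, Q y ->
    -1 - dot (pull (fun e => - join_vec T (ext M) e)) y = \sum_i lam i * sl i y.
  have [matM|no] := pselect (matching M); last by exists (fun=> 0).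
  have [|lam lam_ge0 lamE] := slack (pull (fun e => - join_vec T (ext M) e)) (-1).
    move=> y Qy; rewrite pullE; apply/RleP.
    (* The inequality may be used on the cone because the extended matching crosses [S0] exactly
       once, which makes it tight at [v]. *)
    have : radial_cone (Tcut_dom T) v (linmap L y) by apply/QL; exists y.
    apply; first exact: join_valid (ext_pair M matM).
    by rewrite vE dotN dot_join_cut ?ext_one //; exact: ext_pair.
  by exists lam.
have [lam lam_spec] := choice lamP.
apply: (@le_trans _ _ (60 * (#|F|%:R * (6 * m + 10)%:R))).
  apply: (@matching_slack_rank m F (fun i U => sl i (lift_pt (shore U)))
    (fun i M => lam M i)).
  - by move=> i U oddU; apply: sl_ge0; exact: (lift_ptP _ (shore_odd U oddU)).1.
  - by move=> i M matM; exact: (lam_spec M matM).1.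
  - move=> U M oddU matM; have [Qy yE] := lift_ptP _ (shore_odd U oddU).
    under eq_bigr do rewrite mulrC.
    rewrite -(lam_spec M matM).2 // pullE -(eq_dotr _ yE) dotN.
    by rewrite dot_join_cut ?ext_cross; [rewrite opprK addrC | exact: ext_pair].
  - lra.
by rewrite ler_wpM2l // ler_wpM2r // ler_nat.
Qed.

(** * Choice of constants *)

Lemma Rpower2_le_exp (x : R) : 0 <= x -> Rpower 2 x <= exp x.
Proof.
move=> x_ge0; rewrite /Rpower ler_expR.
have two : exp (ln 2) = 2 by apply: exp_ln; apply/RltP.
have : ln 2 <= 1 by rewrite -ler_expR two; have := expR_ge1D 1; lra.
by move/(ler_wpM2l x_ge0); rewrite mulr1.
Qed.

(** With [z = c * x / 2], [exp (c * x)] is at least [z * z = x * (x * c ^+ 2) / 4]; this is where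
    [240 = 4 * 60] arises. *)
Lemma linear_lt_exp (c x : R) : 0 < c -> 240 / c ^+ 2 <= x -> 60 * x <= exp (c * x).
Proof.
move=> c_gt0 x_big.
have c2_gt0 : 0 < c ^+ 2 by rewrite exprn_gt0.
have x_gt0 : 0 < x by apply: lt_le_trans x_big; rewrite divr_gt0.
have -> : c * x = c * x / 2 + c * x / 2 by field.
rewrite expRD; set z := c * x / 2.
have z_gt0 : 0 < z by rewrite divr_gt0 ?mulr_gt0.
have ez : z <= exp z by have := expR_ge1D z; lra.
apply: le_trans (ler_pM (ltW z_gt0) (ltW z_gt0) ez ez).
have -> : z * z = x * (x * c ^+ 2) / 4 by rewrite /z; field.
have : 240 <= x * c ^+ 2 by rewrite -ler_pdivrMr.
move/(ler_wpM2l (ltW x_gt0)); lra.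
Qed.

Theorem theorem4 :
  exists (c : R) (N0 : nat), Rlt 0 c /\
    forall (n : nat) (T : {set 'I_n}),
      ~~ odd #|T| -> (N0 <= #|T|)%N ->
      forall v : vec (edge n), vertex (Tcut_dom T) v ->
        xc_at_least (radial_cone (Tcut_dom T) v)
                    (Rpower 2 (Rmult c (INR #|T|))).
Proof.
pose delta : R := 1/(300 * 100 * 100).
(* As [t <= 24 * m.+1], the matrix bound is at least [z * z] with [z = exp (c * t)]; one factor [z]
   absorbs the linear factor. *)
pose c : R := delta / 48.
have c_gt0 : 0 < c by rewrite /c /delta; lra.
(* The 40 ensures [m >= 1], and with it [t <= 24 * m.+1]. *)
exists c, (Num.truncn (240 / c ^+ 2) + 40)%N; split; first exact/RltP.
move=> n T evenT big_T v vert k Q L f ext nf.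
set t := #|T| in evenT big_T *.
have t_ge40 : (40 <= t)%N by apply: leq_trans (leq_addl _ _) big_T.
have [t2 tE] : exists t2, t = t2.*2 by exists t./2; rewrite even_halfK.
have [m m_lo m_hi] : exists2 m, (m * 6 <= t2 - 10)%N & (t2 - 10 < m.+1 * 6)%N.
  by exists ((t2 - 10) %/ 6)%N; [exact: leq_divM | exact: ltn_ceil].
have t2_ge : (20 <= t2)%N by move: t_ge40; rewrite tE -muln2; lia.
have m_le : (2 * (6 * m + 10) <= t)%N by rewrite tE -muln2; lia.
have m_ge : (t <= 24 * m.+1)%N by rewrite tE -muln2; lia.
have bound := radial_cone_xc evenT m_le vert ext nf.
have tR : 240 / c ^+ 2 <= t%:R.
  apply/ltW/(lt_le_trans (truncnS_gt _)); rewrite ler_nat.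
  by apply: leq_trans big_T; rewrite -addn1 leq_add2l.
have lin := linear_lt_exp c_gt0 tR.
have t_ge1 : 1 <= t%:R :> R by rewrite (ler_nat _ 1); lia.
set z := exp (c * t%:R) in lin.
have zz : z * z <= 60 * (f.+1%:R * (6 * m + 10)%:R).
  apply: le_trans bound; rewrite -expRD ler_expR.
  have : t%:R <= 24 * m.+1%:R :> R by rewrite -natrM ler_nat.
  have delta_ge0 : 0 <= delta by rewrite /delta; lra.
  move/(ler_wpM2l delta_ge0); rewrite -/delta /c; lra.
have mt : 2 * (6 * m + 10)%:R <= t%:R :> R by rewrite -natrM ler_nat.
apply/RleP; rewrite !INRE; apply: (@le_trans _ _ z).
  by apply: Rpower2_le_exp; rewrite mulr_ge0 ?ler0n ?ltW.
have z_gt0 : 0 < z by exact: expR_gt0.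
have : z * z <= 30 * t%:R * f.+1%:R.
  apply: le_trans zz _; have := ler_wpM2l (ler0n _ f.+1 : 0 <= f.+1%:R :> R) mt; lra.
(* From [60 * t <= z] follows [2 * z <= f + 1], and [1 <= z] removes the 1. *)
rewrite -[f.+1%:R]natr1 => h2; have h1 := ler_wpM2r (ltW z_gt0) lin.
have : t%:R * (2 * z) <= t%:R * (f%:R + 1 : R) by lra.
have z_ge1 : 1 <= z by lra.
rewrite ler_pM2l; last by lra.
lra.
Qed.
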